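(* For the bicrossproduct Minkowski spacetime algebra in $1+1$ dimensions with its 2D calculus, and among bimodule connections $(\nabla,\sigma)$ on $\Omega^1$ of the form (ansatz) \begin{align*} \nabla\mathrm dr&=\tfrac1r(\alpha v\otimes v+\beta v\otimes\mathrm dr+\gamma\mathrm dr\otimes v+\delta\mathrm dr\otimes\mathrm dr),\\ \nabla v&=\tfrac1r(\alpha'v\otimes v+\beta'v\otimes\mathrm dr+\gamma'\mathrm dr\otimes v+\delta'\mathrm dr\otimes\mathrm dr),\\ \sigma(\mathrm dr\otimes\mathrm dr)&=\mathrm dr\otimes\mathrm dr,\qquad\sigma(v\otimes\mathrm dr)=\mathrm dr\otimes v,\\ \sigma(\mathrm dr\otimes v)&=\lambda\alpha v\otimes v+(1+\lambda\beta)v\otimes\mathrm dr+\lambda\gamma\mathrm dr\otimes v+\lambda\delta\mathrm dr\otimes\mathrm dr,\\ \sigma(v\otimes v)&=(1+\lambda\alpha')v\otimes v+\lambda\beta'v\otimes\mathrm dr+\lambda\gamma'\mathrm dr\otimes v+\lambda\delta'\mathrm dr\otimes\mathrm dr \end{align*} with $\mathbb C$-number coefficients $\alpha,\beta,\gamma,\delta,\alpha',\beta',\gamma',\delta'$, those with a classical limit which are torsion free and whose $\sigma$ obeys the braid relations are given by: (i) $\alpha=\beta=\gamma=\alpha'=\beta'=0$, $\delta=\gamma'=2$, i.e. $$\sigma(\mathrm dr\otimes v)=v\otimes\mathrm dr+2\lambda\mathrm dr\otimes\mathrm dr,\quad\sigma(v\otimes v)=v\otimes v+2\lambda\mathrm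 dr\otimes v+\lambda\delta'\mathrm dr\otimes\mathrm dr,\quad\delta'\in\mathbb C;$$ (ii) $\alpha=\beta=\gamma=\delta=\alpha'=\delta'=0$, $-\beta'=\gamma'=1$, i.e. $$\sigma(\mathrm dr\otimes v)=v\otimes\mathrm dr,\quad\sigma(v\otimes v)=v\otimes(v-\lambda\mathrm dr)+\lambda\mathrm dr\otimes v.$$ These are all extendable, $\wedge$-compatible and Leibniz compatible, and flat (so that they are torsion free, flat, $\wedge$-compatible, extendable and Leibniz compatible).
   Context: $A$ is the algebra over $\mathbb C$ generated by $r,t$ with relation $[r,t]=\lambda r$, $\lambda\ne0$ a parameter, with $r$ taken to be invertible so that $1/r$ makes sense. $\Omega^1$ is spanned over $A$ by $\mathrm dr,\mathrm dt$ with $[r,\mathrm dt]=\lambda\mathrm dr$, $[t,\mathrm dt]=\lambda\mathrm dt$, $[r,\mathrm dr]=[t,\mathrm dr]=0$; then $\mathrm dr$ and $v:=r\mathrm dt-t\mathrm dr$ form a central basis of $\Omega^1$. In the exterior algebra $\mathrm dr,\mathrm dt$ obey the usual (Grassmann) relations, equivalently $\mathrm dr\wedge\mathrm dr=0$, $\mathrm dr\wedge v+v\wedge\mathrm dr=0$, $v\wedge v=\lambda v\wedge\mathrm dr$. ''With a classical limit'' means that the coefficients $\alpha,\dots,\delta'$, regarded as depending on $\lambda$, have finite limits as $\lambda\to0$ (solutions in which coefficients are singular as $\lambda\to0$, such as $\alpha'+\beta=-1/\lambda$, are excluded). A bimodule connection $(\nabla,\sigma)$ on $\Omega^1$ is a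 linear map $\nabla:\Omega^1\to\Omega^1\otimes_A\Omega^1$ and a bimodule map $\sigma:\Omega^1\otimes_A\Omega^1\to\Omega^1\otimes_A\Omega^1$ with $\nabla(a\omega)=\mathrm da\otimes\omega+a\nabla\omega$, $\nabla(\omega a)=(\nabla\omega)a+\sigma(\omega\otimes\mathrm da)$. Lower indices indicate position: $\wedge_i,\sigma_i$ act in tensor factors $i,i+1$. Torsion free: $\wedge\nabla=\mathrm d$ on $\Omega^1$; flat: $(\mathrm d\otimes\mathrm{id}-\mathrm{id}\wedge\nabla)\nabla=0$; braid relations: $\sigma_1\sigma_2\sigma_1=\sigma_2\sigma_1\sigma_2$ on $\Omega^{1\otimes_A3}$; extendable: $\omega\otimes\eta\wedge\zeta\mapsto\wedge_1\sigma_2\sigma_1(\omega\otimes\eta\otimes\zeta)$ is a well-defined bimodule map $\Omega^1\otimes_A\Omega^2\to\Omega^2\otimes_A\Omega^1$; $\wedge$-compatible: $\nabla_{\Omega^2}(\eta\wedge\omega):=(\nabla\eta)\wedge\omega+\wedge_2\sigma_1(\eta\otimes\nabla\omega)$ is a well-defined bimodule connection on $\Omega^2$; Leibniz compatible: $\nabla_2\sigma_1=\sigma_2\nabla_2$ on $\Omega^1\otimes_A\Omega^1$, where $\nabla_2=\nabla\otimes\mathrm{id}+\sigma_1(\mathrm{id}\otimes\nabla)$. *)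

(* Defs.v *)
From HB Require Import structures.
From mathcomp Require Import all_boot all_order all_algebra.
From mathcomp Require Import all_classical all_reals all_analysis.
From mathcomp Require Import complex.

Set Implicit Arguments.
Unset Strict Implicit.
Unset Printing Implicit Defensive.

Import Order.TTheory GRing.Theory Num.Theory numFieldNormedType.Exports.

Local Open Scope quotient_scope.
Local Open Scope ring_scope.

Inductive expr (K : Type) : Type :=
| Cst of K
| GenR
| GenRV
| GenT
| Add of expr K & expr K
| Mul of expr K & expr K.
Arguments GenR {K}.
Arguments GenRV {K}.
Arguments GenT {K}.

HB.instance Definition _ (K : Type) := gen_eqMixin (expr K).
HB.instance Definition _ (K : Type) := gen_choiceMixin (expr K).

(* The least congruence making the expressions a unital associative K-algebra
   and imposing r r^-1 = r^-1 r = 1 and r t - t r = lam r. *)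
Inductive cong (K : fieldType) (lam : K) : expr K -> expr K -> Prop :=
| cong_refl x : cong lam x x
| cong_sym x y : cong lam x y -> cong lam y x
| cong_trans x y z : cong lam x y -> cong lam y z -> cong lam x z
| cong_Add x x' y y' :
    cong lam x x' -> cong lam y y' -> cong lam (Add x y) (Add x' y')
| cong_Mul x x' y y' :
    cong lam x x' -> cong lam y y' -> cong lam (Mul x y) (Mul x' y')
| cong_addA x y z : cong lam (Add x (Add y z)) (Add (Add x y) z)
| cong_addC x y : cong lam (Add x y) (Add y x)
| cong_add0 x : cong lam (Add (Cst 0) x) x
| cong_mulA x y z : cong lam (Mul x (Mul y z)) (Mul (Mul x y) z)
| cong_mul0 x : cong lam (Mul (Cst 0) x) (Cst 0)
| cong_mul1 x : cong lam (Mul (Cst 1) x) x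
| cong_mulDl x y z : cong lam (Mul (Add x y) z) (Add (Mul x z) (Mul y z))
| cong_mulDr x y z : cong lam (Mul x (Add y z)) (Add (Mul x y) (Mul x z))
| cong_CstD a b : cong lam (Cst (a + b)) (Add (Cst a) (Cst b))
| cong_CstM a b : cong lam (Cst (a * b)) (Mul (Cst a) (Cst b))
| cong_CstC a x : cong lam (Mul (Cst a) x) (Mul x (Cst a))
| cong_rrV : cong lam (Mul GenR GenRV) (Cst 1)
| cong_rVr : cong lam (Mul GenRV GenR) (Cst 1)
| cong_rt : cong lam (Mul GenR GenT)
                     (Add (Mul GenT GenR) (Mul (Cst lam) GenR)).

Section Algebra.
Variables (K : fieldType) (lam : K).

Definition congb (x y : expr K) : bool := `[< cong lam x y >].

Lemma congb_equiv : equiv_class_of congb.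
Proof.
split.
- by move=> x; apply/asboolP/cong_refl.
- by move=> x y; apply/asboolP/asboolP => /cong_sym.
- by move=> y x z /asboolP h /asboolP h'; apply/asboolP; apply: cong_trans h'.
Qed.

Canonical congb_rel := EquivRelPack congb_equiv.

Definition bcm := {eq_quot congb_rel}.
HB.instance Definition _ := Choice.on bcm.

Definition cls (x : expr K) : bcm := \pi x.

Lemma clsP x y : cls x = cls y <-> cong lam x y.
Proof. by split=> [/eqmodP/asboolP|h] //; apply/eqmodP/asboolP. Qed.

Lemma cls_repr (a : bcm) : cls (repr a) = a.
Proof. exact: reprK. Qed.

Lemma cong_repr x : cong lam (repr (cls x)) x.
Proof. by apply/clsP; rewrite cls_repr. Qed.

Definition bcm_add (a b : bcm) : bcm := cls (Add (repr a) (repr b)).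
Definition bcm_mul (a b : bcm) : bcm := cls (Mul (repr a) (repr b)).
Definition bcm_opp (a : bcm) : bcm := cls (Mul (Cst (- 1)) (repr a)).
Definition bcm_scale (k : K) (a : bcm) : bcm := cls (Mul (Cst k) (repr a)).

Lemma add_cls x y : bcm_add (cls x) (cls y) = cls (Add x y).
Proof. by apply/clsP; apply: cong_Add; apply: cong_repr. Qed.
Lemma mul_cls x y : bcm_mul (cls x) (cls y) = cls (Mul x y).
Proof. by apply/clsP; apply: cong_Mul; apply: cong_repr. Qed.
Lemma opp_cls x : bcm_opp (cls x) = cls (Mul (Cst (- 1)) x).
Proof. by apply/clsP; apply: cong_Mul (cong_refl _ _) (cong_repr _). Qed.
Lemma scale_cls k x : bcm_scale k (cls x) = cls (Mul (Cst k) x).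
Proof. by apply/clsP; apply: cong_Mul (cong_refl _ _) (cong_repr _). Qed.

Definition clsE := (add_cls, mul_cls, opp_cls, scale_cls).

Lemma bcm_ind (P : bcm -> Prop) : (forall x, P (cls x)) -> forall a, P a.
Proof. by move=> h a; rewrite -(cls_repr a). Qed.

Lemma bcm_addA : associative bcm_add.
Proof.
elim/bcm_ind=> x; elim/bcm_ind=> y; elim/bcm_ind=> z.
by rewrite !clsE; apply/clsP/cong_addA.
Qed.
Lemma bcm_addC : commutative bcm_add.
Proof.
by elim/bcm_ind=> x; elim/bcm_ind=> y; rewrite !clsE; apply/clsP/cong_addC.
Qed.
Lemma bcm_add0 : left_id (cls (Cst 0)) bcm_add.
Proof. by elim/bcm_ind=> x; rewrite !clsE; apply/clsP/cong_add0. Qed.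
Lemma bcm_addN : left_inverse (cls (Cst 0)) bcm_opp bcm_add.
Proof.
elim/bcm_ind=> x; rewrite !clsE.
have -> : cls (Add (Mul (Cst (- 1)) x) x)
        = cls (Add (Mul (Cst (- 1)) x) (Mul (Cst 1) x)).
  rewrite -!add_cls; congr bcm_add.
  by apply/clsP/cong_sym/cong_mul1.
apply/clsP; apply: cong_trans (cong_sym (cong_mulDl _ _ _ _)) _.
apply: cong_trans (cong_mul0 _ x); apply: cong_Mul (cong_refl _ _).
by apply: cong_trans (cong_sym (cong_CstD _ _ _)) _; rewrite addNr;
  exact: cong_refl.
Qed.
Lemma bcm_mulA : associative bcm_mul.
Proof.
elim/bcm_ind=> x; elim/bcm_ind=> y; elim/bcm_ind=> z.
by rewrite !clsE; apply/clsP/cong_mulA.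
Qed.
Lemma bcm_mul1 : left_id (cls (Cst 1)) bcm_mul.
Proof. by elim/bcm_ind=> x; rewrite !clsE; apply/clsP/cong_mul1. Qed.
Lemma bcm_1mul : right_id (cls (Cst 1)) bcm_mul.
Proof.
elim/bcm_ind=> x; rewrite !clsE; apply/clsP.
exact: cong_trans (cong_sym (cong_CstC _ _ _)) (cong_mul1 _ _).
Qed.
Lemma bcm_mulDl : left_distributive bcm_mul bcm_add.
Proof.
elim/bcm_ind=> x; elim/bcm_ind=> y; elim/bcm_ind=> z.
by rewrite !clsE; apply/clsP/cong_mulDl.
Qed.
Lemma bcm_mulDr : right_distributive bcm_mul bcm_add.
Proof.
elim/bcm_ind=> x; elim/bcm_ind=> y; elim/bcm_ind=> z.
by rewrite !clsE; apply/clsP/cong_mulDr.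
Qed.

(* A representation on functions int -> K: r shifts, t multiplies by lam n. *)
Fixpoint opr (x : expr K) (f : int -> K) (n : int) : K :=
  match x with
  | Cst k => k * f n
  | GenR => f (n + 1)
  | GenRV => f (n - 1)
  | GenT => lam * n%:~R * f n
  | Add y z => opr y f n + opr z f n
  | Mul y z => opr y (opr z f) n
  end.

Lemma oprD x f g n : opr x (fun m => f m + g m) n = opr x f n + opr x g n.
Proof.
elim: x f g n => [k||||y IHy z IHz|y IHy z IHz] f g n //=.
- by rewrite mulrDr.
- by rewrite mulrDr.
- by rewrite IHy IHz addrACA.
- by rewrite -IHy; congr opr; apply/funext => m; apply: IHz.
Qed.

Lemma oprZ x k f n : opr x (fun m => k * f m) n = k * opr x f n.
Proof.
elim: x f n => [a||||y IHy z IHz|y IHy z IHz] f n //=.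
- by rewrite mulrCA.
- by rewrite mulrCA.
- by rewrite IHy IHz mulrDr.
- by rewrite -IHy; congr opr; apply/funext => m; apply: IHz.
Qed.

Lemma opr_cong x y : cong lam x y -> opr x = opr y.
Proof.
elim=> //=.
- by move=> ? ? ? _ -> _ ->.
- by move=> ? ? ? ? _ e1 _ e2; apply/funext => f; apply/funext=> n /=;
    rewrite e1 e2.
- by move=> ? ? ? ? _ e1 _ e2; apply/funext => f; apply/funext=> n /=;
    rewrite e1 e2.
- by move=> ? ? ?; apply/funext => f; apply/funext=> n /=; rewrite addrA.
- by move=> ? ?; apply/funext => f; apply/funext=> n /=; rewrite addrC.
- by move=> ?; apply/funext => f; apply/funext=> n /=; rewrite mul0r add0r.
- by move=> ?; apply/funext => f; apply/funext=> n /=; rewrite !mul0r.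
- by move=> ?; apply/funext => f; apply/funext=> n /=; rewrite mul1r.
- by move=> x' y' z'; apply/funext => f; apply/funext=> n /=; rewrite oprD.
- by move=> a b; apply/funext => f; apply/funext=> n /=; rewrite mulrDl.
- by move=> a b; apply/funext => f; apply/funext=> n /=; rewrite mulrA.
- by move=> a x'; apply/funext => f; apply/funext=> n /=; rewrite oprZ.
- by apply/funext => f; apply/funext=> n /=; rewrite mul1r addrK.
- by apply/funext => f; apply/funext=> n /=; rewrite mul1r subrK.
- apply/funext => f; apply/funext=> n /=.
  by rewrite rmorphD /= mulrDr mulrDl mulr1.
Qed.

Lemma bcm_1neq0 : cls (Cst 1) != cls (Cst 0).
Proof.
apply/eqP => /clsP/opr_cong/(congr1 (fun F => F (fun=> 1) 0)) /= /eqP.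
by rewrite mul1r mul0r oner_eq0.
Qed.

HB.instance Definition _ := GRing.isNzRing.Build bcm
  bcm_addA bcm_addC bcm_add0 bcm_addN bcm_mulA bcm_mul1 bcm_1mul
  bcm_mulDl bcm_mulDr bcm_1neq0.

Lemma bcm_scaleA k l a : bcm_scale k (bcm_scale l a) = bcm_scale (k * l) a.
Proof.
elim/bcm_ind: a => x; rewrite !clsE; apply/clsP.
apply: cong_trans (cong_mulA _ _ _ _) _.
exact: cong_Mul (cong_sym (cong_CstM _ _ _)) (cong_refl _ _).
Qed.
Lemma bcm_scale1 : left_id 1 bcm_scale.
Proof. by elim/bcm_ind=> x; rewrite !clsE; apply/clsP/cong_mul1. Qed.
Lemma bcm_scaleDr : right_distributive bcm_scale +%R.
Proof.
move=> k; elim/bcm_ind=> x; elim/bcm_ind=> y; rewrite /GRing.add /=.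
by rewrite !clsE; apply/clsP/cong_mulDr.
Qed.
Lemma bcm_scaleDl a : {morph bcm_scale^~ a : k l / k + l}.
Proof.
elim/bcm_ind: a => x k l /=; rewrite [RHS]/GRing.add /= !clsE; apply/clsP.
apply: cong_trans (cong_mulDl _ _ _ _).
exact: cong_Mul (cong_CstD _ _ _) (cong_refl _ _).
Qed.
HB.instance Definition _ := GRing.Zmodule_isLmodule.Build K bcm
  bcm_scaleA bcm_scale1 bcm_scaleDr bcm_scaleDl.

Lemma bcm_scaleAl (k : K) (a b : bcm) : k *: (a * b) = (k *: a) * b.
Proof.
elim/bcm_ind: a => x; elim/bcm_ind: b => y.
by rewrite /GRing.scale /GRing.mul /= !clsE; apply/clsP/cong_mulA.
Qed.
HB.instance Definition _ := GRing.Lmodule_isLalgebra.Build K bcm bcm_scaleAl.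

Lemma bcm_scaleAr (k : K) (a b : bcm) : k *: (a * b) = a * (k *: b).
Proof.
elim/bcm_ind: a => x; elim/bcm_ind: b => y.
rewrite /GRing.scale /GRing.mul /= !clsE; apply/clsP.
apply: cong_trans (cong_mulA _ _ _ _) _; apply: cong_trans.
  exact: cong_Mul (cong_CstC _ _ _) (cong_refl _ _).
exact: cong_sym (cong_mulA _ _ _ _).
Qed.
HB.instance Definition _ := GRing.Lalgebra_isAlgebra.Build K bcm bcm_scaleAr.

Definition bcr : bcm := cls GenR.
Definition bcrV : bcm := cls GenRV.
Definition bct : bcm := cls GenT.

Lemma cls_Add x y : cls (Add x y) = cls x + cls y.
Proof. by rewrite -add_cls. Qed.
Lemma cls_Mul x y : cls (Mul x y) = cls x * cls y.
Proof. by rewrite -mul_cls. Qed.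
Lemma cls_Cst k : cls (Cst k) = k%:A.
Proof.
rewrite [RHS](_ : _ = cls (Mul (Cst k) (Cst 1))); last by rewrite -scale_cls.
by apply/clsP; apply: cong_trans (cong_CstC _ _ _); apply/cong_sym/cong_mul1.
Qed.

Lemma bcr_bcrV : bcr * bcrV = 1.
Proof. by rewrite -cls_Mul; apply/clsP/cong_rrV. Qed.
Lemma bcrV_bcr : bcrV * bcr = 1.
Proof. by rewrite -cls_Mul; apply/clsP/cong_rVr. Qed.
Lemma comm_bcr_bct : bcr * bct - bct * bcr = lam *: bcr.
Proof.
apply/eqP; rewrite subr_eq addrC; apply/eqP.
rewrite -mulr_algl -cls_Cst -!cls_Mul -cls_Add.
by apply/clsP/cong_rt.
Qed.

Lemma bcm_gen_ind (P : bcm -> Prop) :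
  (forall k : K, P k%:A) -> P bcr -> P bcrV -> P bct ->
  (forall a b, P a -> P b -> P (a + b)) ->
  (forall a b, P a -> P b -> P (a * b)) -> forall a, P a.
Proof.
move=> Pk Pr PrV Pt PD PM; elim/bcm_ind.
elim=> [k||||x Px y Py|x Px y Py] //; first by rewrite cls_Cst.
  by rewrite cls_Add; apply: PD.
by rewrite cls_Mul; apply: PM.
Qed.

Section Universal.
Variables (B : algType K) (r' rV' t' : B).
Hypotheses (rrV' : r' * rV' = 1) (rVr' : rV' * r' = 1)
  (rt' : r' * t' - t' * r' = lam *: r').

Fixpoint evalx (x : expr K) : B :=
  match x with
  | Cst k => k%:A
  | GenR => r'
  | GenRV => rV'
  | GenT => t'
  | Add y z => evalx y + evalx z
  | Mul y z => evalx y * evalx z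
  end.

Lemma evalx_cong x y : cong lam x y -> evalx x = evalx y.
Proof.
elim=> //=.
- by move=> ? ? ? _ -> _ ->.
- by move=> ? ? ? ? _ -> _ ->.
- by move=> ? ? ? ? _ -> _ ->.
- by move=> *; rewrite addrA.
- by move=> *; rewrite addrC.
- by move=> *; rewrite scale0r add0r.
- by move=> *; rewrite mulrA.
- by move=> *; rewrite scale0r mul0r.
- by move=> *; rewrite scale1r mul1r.
- by move=> *; rewrite mulrDl.
- by move=> *; rewrite mulrDr.
- by move=> *; rewrite scalerDl.
- by move=> *; rewrite mulr_algl scalerA.
- by move=> *; rewrite mulr_algl mulr_algr.
- by rewrite rrV' scale1r.
- by rewrite rVr' scale1r.
- by rewrite mulr_algl -rt' addrC subrK.
Qed.

Lemma bcm_universal : exists f : {lrmorphism bcm -> B},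
  [/\ f bcr = r', f bcrV = rV' & f bct = t'] /\
  forall g : {lrmorphism bcm -> B},
    [/\ g bcr = r', g bcrV = rV' & g bct = t'] -> f =1 g.
Proof.
pose f (a : bcm) : B := evalx (repr a).
have fc x : f (cls x) = evalx x by apply/evalx_cong/cong_repr.
have fD : {morph f : a b / a + b}.
  by elim/bcm_ind=> x; elim/bcm_ind=> y; rewrite -cls_Add !fc.
have fM : {morph f : a b / a * b}.
  by elim/bcm_ind=> x; elim/bcm_ind=> y; rewrite -cls_Mul !fc.
have fC k : f k%:A = k%:A by rewrite -cls_Cst fc.
have f1 : f 1 = 1 by rewrite -[1 in LHS]scale1r fC scale1r.
have fN : {morph f : a / - a}.
  move=> a; rewrite -[in LHS]scaleN1r -mulr_algl fM fC.
  by rewrite mulr_algl scaleN1r.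
have fZ : scalable f by move=> k a; rewrite -mulr_algl fM fC mulr_algl.
have fB : zmod_morphism f by move=> a b; rewrite fD fN.
have fm : monoid_morphism f by split.
pose mA := GRing.isZmodMorphism.Build _ _ f fB.
pose mM := GRing.isMonoidMorphism.Build _ _ f fm.
pose mZ := GRing.isScalable.Build K bcm B *:%R f fZ.
pose F : {lrmorphism bcm -> B} := HB.pack f mA mM mZ.
exists F; split; first by split; rewrite /= fc.
move=> g [gr_ grV_ gt_]; apply: bcm_gen_ind => //=.
- by move=> k; rewrite fC linearZ /= rmorph1.
- by rewrite fc.
- by rewrite fc.
- by rewrite fc.
- by move=> a b ea eb; rewrite fD ea eb rmorphD.
- by move=> a b ea eb; rewrite fM ea eb rmorphM.
Qed.
End Universal.

End Algebra.

(* The free left A-module on [I]; letting the basis be central ([bas_central])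
   turns it into an A-bimodule. *)
Definition fbim (A : nzRingType) (I : finType) := {ffun I -> A}.
HB.instance Definition _ A I := GRing.Zmodule.on (fbim A I).

Section Fbim.
Variables (A : nzRingType) (I : finType).
Implicit Types (a b : A) (x y : fbim A I).

Definition lact a x : fbim A I := [ffun i => a * x i].

Lemma lactA a b x : lact a (lact b x) = lact (a * b) x.
Proof. by apply/ffunP=> i; rewrite !ffunE mulrA. Qed.
Lemma lact1 : left_id 1 lact.
Proof. by move=> x; apply/ffunP=> i; rewrite !ffunE mul1r. Qed.
Lemma lactDr : right_distributive lact +%R.
Proof. by move=> a x y; apply/ffunP=> i; rewrite !ffunE mulrDr. Qed.
Lemma lactDl x : {morph lact^~ x : a b / a + b}.
Proof. by move=> a b; apply/ffunP=> i; rewrite !ffunE mulrDl. Qed.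
HB.instance Definition _ := GRing.Zmodule_isLmodule.Build A (fbim A I)
  lactA lact1 lactDr lactDl.
End Fbim.

Section Bimodules.
Variable A : nzRingType.
Implicit Types I J L : finType.

Definition ract I (x : fbim A I) (a : A) : fbim A I := [ffun i => x i * a].

Definition bas I (i : I) : fbim A I := [ffun j => (j == i)%:R].

Definition tens I J (x : fbim A I) (y : fbim A J) : fbim A (I * J)%type :=
  [ffun p => x p.1 * y p.2].

Definition additive_map I J (f : fbim A I -> fbim A J) : Prop :=
  {morph f : x y / x + y}.

Definition bimodule_map I J (f : fbim A I -> fbim A J) : Prop :=
  [/\ additive_map f,
      forall a x, f (a *: x) = a *: f x
    & forall a x, f (ract x a) = ract (f x) a].

(* f (x) id and id (x) f, see [tmapl_tens] and [tmapr_tens]. *)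
Definition tmapl I J L (f : fbim A I -> fbim A L) (x : fbim A (I * J)%type)
    : fbim A (L * J)%type :=
  [ffun p => f [ffun i => x (i, p.2)] p.1].

Definition tmapr I J L (f : fbim A J -> fbim A L) (x : fbim A (I * J)%type)
    : fbim A (I * L)%type :=
  [ffun p => f [ffun j => x (p.1, j)] p.2].

Definition tassoc I J L (x : fbim A (I * J * L)%type)
    : fbim A (I * (J * L))%type :=
  [ffun p => x (p.1, p.2.1, p.2.2)].

Definition tassocV I J L (x : fbim A (I * (J * L))%type)
    : fbim A (I * J * L)%type :=
  [ffun p => x (p.1.1, (p.1.2, p.2))].

Lemma fDE I (x y : fbim A I) i : (x + y) i = x i + y i.
Proof. by rewrite ffunE. Qed.
Lemma fNE I (x : fbim A I) i : (- x) i = - x i.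
Proof. by rewrite ffunE. Qed.
Lemma f0E I i : (0 : fbim A I) i = 0.
Proof. by rewrite ffunE. Qed.
Lemma fZE I a (x : fbim A I) i : (a *: x) i = a * x i.
Proof. by rewrite ffunE. Qed.
Lemma ractE I (x : fbim A I) a i : ract x a i = x i * a.
Proof. by rewrite ffunE. Qed.
Lemma tensE I J (x : fbim A I) (y : fbim A J) p : tens x y p = x p.1 * y p.2.
Proof. by rewrite ffunE. Qed.
Lemma basjE I (i j : I) : bas i j = (j == i)%:R.
Proof. by rewrite ffunE. Qed.
Lemma fsumE I (T : finType) (F : T -> fbim A I) i :
  (\sum_k F k) i = \sum_k F k i.
Proof. exact: (big_morph (fun x : fbim A I => x i) (fun x y => fDE x y i) (f0E i)). Qed.

Definition coefE := (fDE, fNE, f0E, fZE, ractE, tensE).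

Lemma bas_central I (i : I) (a : A) : ract (bas i) a = a *: bas i.
Proof.
apply/ffunP=> j; rewrite !(coefE, basjE).
by case: (j == i); rewrite ?mulr1 ?mul1r ?mulr0 ?mul0r.
Qed.

Lemma ractD I (x y : fbim A I) a : ract (x + y) a = ract x a + ract y a.
Proof. by apply/ffunP=> i; rewrite !(coefE, basjE) mulrDl. Qed.

Lemma ract0 I a : ract (0 : fbim A I) a = 0.
Proof. by apply/ffunP=> i; rewrite !coefE mul0r. Qed.

Lemma ractM I (x : fbim A I) a b : ract (ract x a) b = ract x (a * b).
Proof. by apply/ffunP=> i; rewrite !(coefE, basjE) mulrA. Qed.

Lemma ractZ I (x : fbim A I) a b : ract (a *: x) b = a *: ract x b.
Proof. by apply/ffunP=> i; rewrite !(coefE, basjE) mulrA. Qed.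

Lemma basE I (x : fbim A I) : x = \sum_i x i *: bas i.
Proof.
apply/ffunP=> j; rewrite fsumE (bigD1 j) //= big1 => [|i ij].
  by rewrite !(coefE, basjE) eqxx mulr1 addr0.
by rewrite !(coefE, basjE) eq_sym (negbTE ij) mulr0.
Qed.

Lemma tensDl I J (x x' : fbim A I) (y : fbim A J) :
  tens (x + x') y = tens x y + tens x' y.
Proof. by apply/ffunP=> p; rewrite !(coefE, basjE) mulrDl. Qed.

Lemma tensDr I J (x : fbim A I) (y y' : fbim A J) :
  tens x (y + y') = tens x y + tens x y'.
Proof. by apply/ffunP=> p; rewrite !(coefE, basjE) mulrDr. Qed.

Lemma tens_balanced I J (x : fbim A I) (y : fbim A J) a :
  tens (ract x a) y = tens x (a *: y).
Proof. by apply/ffunP=> p; rewrite !(coefE, basjE) mulrA. Qed.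

Lemma tensZl I J (x : fbim A I) (y : fbim A J) a :
  tens (a *: x) y = a *: tens x y.
Proof. by apply/ffunP=> p; rewrite !(coefE, basjE) mulrA. Qed.

Lemma tens_ract I J (x : fbim A I) (y : fbim A J) a :
  tens x (ract y a) = ract (tens x y) a.
Proof. by apply/ffunP=> p; rewrite !(coefE, basjE) mulrA. Qed.

Lemma tens_bas I J (i : I) (j : J) : tens (bas i) (bas j) = bas (i, j).
Proof.
apply/ffunP=> -[k l]; rewrite !(coefE, basjE) /= xpair_eqE.
by case: (k == i); rewrite ?mul1r ?mul0r.
Qed.

(* [tens] is the tensor product over A. *)
Lemma tens_universal I J (M : zmodType) (f : fbim A I -> fbim A J -> M) :
  (forall x x' y, f (x + x') y = f x y + f x' y) ->
  (forall x y y', f x (y + y') = f x y + f x y') ->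
  (forall x a y, f (ract x a) y = f x (a *: y)) ->
  exists g : fbim A (I * J)%type -> M,
    [/\ {morph g : z z' / z + z'}, forall x y, g (tens x y) = f x y
      & forall h : fbim A (I * J)%type -> M,
          {morph h : z z' / z + z'} -> (forall x y, h (tens x y) = f x y) ->
          h =1 g].
Proof.
move=> fDl fDr fb.
have f0l y : f 0 y = 0 by apply: (addrI (f 0 y)); rewrite -fDl !addr0.
have f0r x : f x 0 = 0 by apply: (addrI (f x 0)); rewrite -fDr !addr0.
have fsl (T : finType) (F : T -> fbim A I) y :
    f (\sum_i F i) y = \sum_i f (F i) y.
  exact: (big_morph (fun x => f x y) (fun x x' => fDl x x' y) (f0l y)).
have fsr (T : finType) x (F : T -> fbim A J) :
    f x (\sum_i F i) = \sum_i f x (F i).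
  exact: (big_morph (f x) (fDr x) (f0r x)).
pose g (z : fbim A (I * J)%type) : M := \sum_p f (z p *: bas p.1) (bas p.2).
exists g; split.
- move=> z z'; rewrite /g -big_split; apply: eq_bigr => p _.
  by rewrite ffunE scalerDl fDl.
- move=> x y; rewrite [x in RHS]basE [y in RHS]basE fsl /g.
  under [RHS]eq_bigr do rewrite fsr.
  rewrite pair_bigA; apply: eq_bigr => -[i j] _ /=.
  rewrite -fb ractZ bas_central scalerA; congr (f _ _).
  by rewrite !coefE.
- move=> h hD hf z.
  have h0 : h 0 = 0 by apply: (addrI (h 0)); rewrite -hD !addr0.
  rewrite {1}[z]basE (big_morph h hD h0); apply: eq_bigr => -[i j] _ /=.
  by rewrite -hf tensZl tens_bas.
Qed.

Lemma tmapl_tens I J L (f : fbim A I -> fbim A L) x (y : fbim A J) :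
  bimodule_map f -> tmapl f (tens x y) = tens (f x) y.
Proof.
case=> _ _ fr; apply/ffunP=> p; rewrite !ffunE.
rewrite (_ : [ffun i => _] = ract x (y p.2)) ?fr ?ffunE //.
by apply/ffunP=> i; rewrite !ffunE.
Qed.

Lemma tmapr_tens I J L (f : fbim A J -> fbim A L) (x : fbim A I) y :
  bimodule_map f -> tmapr f (tens x y) = tens x (f y).
Proof.
case=> _ fl _; apply/ffunP=> p; rewrite !ffunE.
rewrite (_ : [ffun j => _] = x p.1 *: y) ?fl ?ffunE //.
by apply/ffunP=> i; rewrite !ffunE.
Qed.

Lemma tassoc_tens I J L (x : fbim A I) (y : fbim A J) (z : fbim A L) :
  tassoc (tens (tens x y) z) = tens x (tens y z).
Proof. by apply/ffunP=> p; rewrite !ffunE mulrA. Qed.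

Lemma tassocVK I J L : cancel (@tassocV I J L) (@tassoc I J L).
Proof. by move=> x; apply/ffunP=> -[i [j l]]; rewrite !ffunE. Qed.

Lemma tassocK I J L : cancel (@tassoc I J L) (@tassocV I J L).
Proof. by move=> x; apply/ffunP=> -[[i j] l]; rewrite !ffunE. Qed.

End Bimodules.

Notation "x ⊗ y" := (tens x y) (at level 40, left associativity) : ring_scope.

(* The central basis dr, v of Omega^1 is indexed by [bool] and the central
   basis v /\ dr of Omega^2 by [unit]. *)
Notation Om1 lam := (fbim (bcm lam) bool).
Notation Om2 lam := (fbim (bcm lam) unit).
Notation Om11 lam := (fbim (bcm lam) (bool * bool)%type).
Notation Om111 lam := (fbim (bcm lam) (bool * bool * bool)%type).
Notation Om12 lam := (fbim (bcm lam) (bool * unit)%type).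
Notation Om21 lam := (fbim (bcm lam) (unit * bool)%type).

Section Calculus.
Variables (K : fieldType) (lam : K).
Local Notation A := (bcm lam).
Local Notation r := (bcr lam).
Local Notation rV := (bcrV lam).
Local Notation t := (bct lam).

Definition dr : Om1 lam := bas A false.
Definition vr : Om1 lam := bas A true.
(* Solved from v = r dt - t dr. *)
Definition dt : Om1 lam := rV *: (vr + t *: dr).

Definition vol : Om2 lam := bas A tt.

(* The derivation A -> Omega^1 with r |-> dr and t |-> dt. *)
Fixpoint dexpr (x : expr K) : Om1 lam :=
  match x with
  | Cst _ => 0
  | GenR => dr
  | GenRV => - ract (rV *: dr) rV
  | GenT => dt
  | Add y z => dexpr y + dexpr z
  | Mul y z => ract (dexpr y) (cls lam z) + cls lam y *: dexpr z
  end.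

Definition d0 (a : A) : Om1 lam := dexpr (repr a).

(* From dr /\ dr = 0, dr /\ v = - v /\ dr and v /\ v = lam v /\ dr. *)
Definition wedge (x : Om11 lam) : Om2 lam :=
  (x (true, false) - x (false, true) + x (true, true) * lam%:A) *: vol.

(* d v = d (r dt - t dr). *)
Definition dv : Om2 lam := wedge (dr ⊗ dt) - wedge (dt ⊗ dr).

(* d (a dr + b v) = da /\ dr + db /\ v + b dv. *)
Definition d1 (w : Om1 lam) : Om2 lam :=
  wedge (d0 (w false) ⊗ dr) + wedge (d0 (w true) ⊗ vr) + w true *: dv.

Lemma rV_comm_t : t * rV - rV * t = lam *: rV.
Proof.
have <- : rV * (r * t - t * r) * rV = lam *: rV.
  by rewrite comm_bcr_bct -scalerAr bcrV_bcr -scalerAl mul1r.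
by rewrite mulrBr mulrBl !mulrA bcrV_bcr mul1r -(mulrA _ r rV)
  bcr_bcrV mulr1.
Qed.

Lemma bas_coef (w : Om1 lam) : w = w false *: dr + w true *: vr.
Proof. by rewrite {1}[w]basE big_bool addrC. Qed.

Lemma dr_central a : ract dr a = a *: dr. Proof. exact: bas_central. Qed.
Lemma vr_central a : ract vr a = a *: vr. Proof. exact: bas_central. Qed.

Lemma vrE : vr = r *: dt - t *: dr.
Proof. by rewrite /dt scalerA bcr_bcrV scale1r addrK. Qed.

Lemma dr_false : dr false = 1. Proof. exact: basjE. Qed.
Lemma dr_true : dr true = 0. Proof. exact: basjE. Qed.
Lemma vr_false : vr false = 0. Proof. exact: basjE. Qed.
Lemma vr_true : vr true = 1. Proof. exact: basjE. Qed.
Definition basisE := (dr_false, dr_true, vr_false, vr_true).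

Lemma dt_false : dt false = rV * t.
Proof. by rewrite !coefE !basisE mulr1 add0r. Qed.
Lemma dt_true : dt true = rV.
Proof. by rewrite !coefE !basisE mulr0 addr0 mulr1. Qed.

Definition basis1E := (basisE, dt_false, dt_true).
Definition crdE := (dt_false, dt_true, basisE, coefE).
Definition simp01 := (mulr0, mul0r, mulr1, mul1r, oppr0, addr0, add0r).

Lemma om1P (w w' : Om1 lam) :
  w false = w' false -> w true = w' true -> w = w'.
Proof. by move=> e e'; apply/ffunP; case. Qed.

Lemma comm_t_dt : t *: dt - ract dt t = lam%:A *: dt.
Proof.
apply: om1P; rewrite !crdE mulr_algl; last exact: rV_comm_t.
by rewrite mulrA -mulrBl rV_comm_t scalerAl.
Qed.

Lemma comm_r_dt : r *: dt - ract dt r = lam%:A *: dr.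
Proof.
apply: om1P; rewrite !crdE mulr_algl; last first.
  by rewrite bcr_bcrV bcrV_bcr subrr scaler0.
have <- : rV * (r * t - t * r) = lam *: 1.
  by rewrite comm_bcr_bct -scalerAr bcrV_bcr.
by rewrite mulrBr !mulrA bcr_bcrV bcrV_bcr.
Qed.

Lemma om1_basis (w : Om1 lam) :
  exists a b, w = a *: dr + b *: dt /\
    forall a' b', w = a' *: dr + b' *: dt -> a' = a /\ b' = b.
Proof.
exists (w false - w true * r * (rV * t)), (w true * r); split.
  apply: om1P; rewrite !crdE; first by rewrite mulr1 subrK.
  by rewrite mulr0 add0r -mulrA bcr_bcrV mulr1.
move=> a b ->; rewrite !crdE !simp01 -(mulrA b) bcrV_bcr mulr1.
by rewrite addrK.
Qed.

Lemma dexpr_cong x y : cong lam x y -> dexpr x = dexpr y.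
Proof.
elim=> {x y} //=.
- by move=> ? ? ? _ -> _ ->.
- by move=> ? ? ? ? _ -> _ ->.
- move=> x x' y y' /clsP ex -> /clsP ey ->.
  by rewrite ex ey.
- by move=> *; rewrite addrA.
- by move=> *; rewrite addrC.
- by move=> *; rewrite add0r.
- move=> x y z; rewrite !cls_Mul scalerDr ractD ractZ scalerA addrA.
  by rewrite ractM.
- by move=> x; rewrite cls_Cst !scale0r addr0 ract0.
- by move=> x; rewrite cls_Cst !scale1r ract0 add0r.
- by move=> x y z; rewrite cls_Add scalerDl ractD addrACA.
- move=> x y z; rewrite cls_Add scalerDr addrACA; congr (_ + _).
  by apply: om1P; rewrite !coefE mulrDr.
- by move=> *; rewrite addr0.
- by move=> a b; rewrite scaler0 addr0 ract0.
- move=> a x; rewrite scaler0 addr0 cls_Cst ract0 add0r.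
  by apply: om1P; rewrite !coefE mulr_algl mulr_algr.
- rewrite -/r -/rV; apply: om1P; rewrite !crdE !simp01 //.
  by rewrite mulrN mulrA bcr_bcrV mul1r subrr.
- rewrite -/r -/rV; apply: om1P; rewrite !crdE !simp01 //.
  by rewrite mulNr -mulrA bcrV_bcr mulr1 addNr.
- rewrite dr_central -/t -/r cls_Cst ract0 add0r -comm_r_dt.
  rewrite [X in _ = X + _]addrC -addrA; congr (_ + _).
  by rewrite addrC subrK.
Qed.

Lemma d0_cls x : d0 (cls lam x) = dexpr x.
Proof. exact/dexpr_cong/cong_repr. Qed.

Lemma d0D : {morph d0 : a b / a + b}.
Proof. by elim/bcm_ind=> x; elim/bcm_ind=> y; rewrite -cls_Add !d0_cls. Qed.

Lemma d0M a b : d0 (a * b) = ract (d0 a) b + a *: d0 b.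
Proof.
by elim/bcm_ind: a => x; elim/bcm_ind: b => y; rewrite -cls_Mul !d0_cls.
Qed.

Lemma d0_Cst k : d0 k%:A = 0. Proof. by rewrite -cls_Cst d0_cls. Qed.
Lemma d0_r : d0 r = dr. Proof. by rewrite d0_cls. Qed.
Lemma d0_t : d0 t = dt. Proof. by rewrite d0_cls. Qed.
Lemma d0_rV : d0 rV = - (rV * rV) *: dr.
Proof. by rewrite d0_cls /= ractZ dr_central scalerA scaleNr. Qed.

Lemma wedge_bimodule : bimodule_map wedge.
Proof.
split.
- move=> x y; rewrite /wedge -scalerDl; congr (_ *: _).
  by rewrite !coefE mulrDl opprD [X in X + _]addrACA [LHS]addrACA.
- move=> a x; rewrite /wedge scalerA; congr (_ *: _).
  by rewrite !coefE -mulrA -mulrBr -mulrDr.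
- move=> a x; rewrite /wedge ractZ bas_central scalerA; congr (_ *: _).
  rewrite !coefE mulrDl mulrBl; congr (_ + _).
  by rewrite -!mulrA mulr_algl mulr_algr.
Qed.

Lemma wedge_dr_dr : wedge (dr ⊗ dr) = 0.
Proof. by rewrite /wedge !tensE /= !crdE !simp01 scale0r. Qed.
Lemma wedge_v_dr : wedge (vr ⊗ dr) = vol.
Proof. by rewrite /wedge !tensE /= !crdE !simp01 scale1r. Qed.
Lemma wedge_dr_v : wedge (dr ⊗ vr) = - vol.
Proof. by rewrite /wedge !tensE /= !crdE !simp01 scaleN1r. Qed.
Lemma wedge_v_v : wedge (vr ⊗ vr) = lam%:A *: vol.
Proof. by rewrite /wedge !tensE /= !crdE !simp01. Qed.

Lemma om11P (x y : Om11 lam) :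
  x (false, false) = y (false, false) -> x (false, true) = y (false, true) ->
  x (true, false) = y (true, false) -> x (true, true) = y (true, true) ->
  x = y.
Proof. by move=> *; apply/ffunP; case=> [[] []]. Qed.

Lemma wedge_dr_dt : wedge (dr ⊗ dt) = - rV *: vol.
Proof. by rewrite /wedge !tensE /= !crdE !simp01. Qed.
Lemma wedge_dt_dr : wedge (dt ⊗ dr) = rV *: vol.
Proof. by rewrite /wedge !tensE /= !crdE !simp01. Qed.
Lemma wedge_dt_dt : wedge (dt ⊗ dt) = 0.
Proof.
rewrite /wedge !tensE /= !crdE -[RHS](scale0r vol) /=; congr (_ *: _).
rewrite mulr_algr scalerAr -rV_comm_t mulrBr !mulrA.
by rewrite addrC subrKA subrr.
Qed.

Lemma wedge_surj (y : Om2 lam) : exists x, wedge x = y.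
Proof.
exists (y tt *: (vr ⊗ dr)); case: wedge_bimodule => _ -> _.
by rewrite wedge_v_dr; apply/ffunP; case; rewrite fZE basjE mulr1.
Qed.

(* Omega^2 is Omega^1 (x) Omega^1 modulo the usual Grassmann relations. *)
Lemma wedge_ker (x : Om11 lam) :
  wedge x = 0 <->
  exists a b c, x = a *: (dr ⊗ dr) + b *: (dr ⊗ dt + dt ⊗ dr) + c *: (dt ⊗ dt).
Proof.
have [wD wl _] := wedge_bimodule.
have wrel a b c :
    wedge (a *: (dr ⊗ dr) + b *: (dr ⊗ dt + dt ⊗ dr) + c *: (dt ⊗ dt)) = 0.
  rewrite !(wD, wl) wedge_dr_dr wedge_dt_dt.
  by rewrite wedge_dr_dt wedge_dt_dr scaleNr addNr !scaler0 !addr0.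
split=> [x0|[a [b [c ->]]]]; last exact: wrel.
pose c := x (true, true) * r * r.
pose b := (x (true, false) - c * (rV * (rV * t))) * r.
pose a := x (false, false) - b * (rV * t + rV * t) - c * (rV * t * (rV * t)).
exists a, b, c; set y := (X in _ = X).
have y0 : wedge (x - y) = 0.
  by rewrite wD x0 add0r -scaleN1r wl wrel scaler0.
have canc (u p q : A) : u - p - q + p + q = u by rewrite addrAC !subrK.
have e00 : (x - y) (false, false) = 0.
  by rewrite fDE fNE /y !coefE /= !crdE !simp01 /a canc subrr.
have e11 : (x - y) (true, true) = 0.
  rewrite fDE fNE /y !coefE /= !crdE !simp01 /c mulrA -(mulrA _ r rV) bcr_bcrV mulr1.
  by rewrite -mulrA bcr_bcrV mulr1 subrr.
have e10 : (x - y) (true, false) = 0.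
  rewrite fDE fNE /y !coefE /= !crdE !simp01 /b -(mulrA _ r rV) bcr_bcrV mulr1 subrK.
  by rewrite subrr.
apply/eqP; rewrite -subr_eq0; apply/eqP; apply: om11P; rewrite ?f0E //.
move: (x - y) y0 e10 e11 => z /(congr1 (fun u : Om2 lam => u tt)) + e10 e11.
rewrite /wedge e11 e10 fZE basjE f0E !simp01 => /eqP.
by rewrite oppr_eq0 => /eqP.
Qed.

Lemma dvE : dv = - (rV + rV) *: vol.
Proof. by rewrite /dv wedge_dr_dt wedge_dt_dr -scalerBl opprD. Qed.

Lemma d0_true a : (d0 a) true * lam%:A = a * rV - rV * a.
Proof.
elim/bcm_gen_ind: a => [k||||a b ea eb|a b ea eb].
- by rewrite d0_Cst f0E mul0r mulr_algl mulr_algr subrr.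
- by rewrite d0_r !crdE mul0r bcr_bcrV bcrV_bcr subrr.
- by rewrite d0_rV !crdE mulr0 mul0r subrr.
- by rewrite d0_t !crdE mulr_algr rV_comm_t.
- by rewrite d0D fDE mulrDl ea eb mulrDl mulrDr opprD addrACA.
- rewrite d0M !coefE mulrDl -!mulrA eb.
  rewrite (_ : b * lam%:A = lam%:A * b); last by rewrite mulr_algl mulr_algr.
  by rewrite (mulrA (d0 a true)) ea mulrBl mulrBr !mulrA addrC subrKA.
Qed.

Lemma d1D : {morph d1 : w w' / w + w'}.
Proof.
have [wD wl _] := wedge_bimodule.
move=> w w'; rewrite /d1; move: dv => D; rewrite !fDE !d0D !tensDl !wD scalerDl.
by rewrite [X in X + _]addrACA [LHS]addrACA.
Qed.

Lemma d1Ml a w : d1 (a *: w) = wedge (d0 a ⊗ w) + a *: d1 w.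
Proof.
have [wD wl _] := wedge_bimodule.
rewrite [in wedge (d0 a ⊗ _)](bas_coef w) /d1; move: dv => D.
rewrite !fZE !d0M tensDr !tensDl.
rewrite !tens_balanced !tensZl !wD !wl !scalerDr (scalerA a (w true) D) [RHS]addrA.
by congr (_ + _); exact: addrACA.
Qed.

Lemma d0N a : d0 (- a) = - d0 a.
Proof.
have -> : - a = (- 1)%:A * a by rewrite mulr_algl scaleN1r.
rewrite d0M d0_Cst ract0 add0r.
by apply: om1P; rewrite !coefE mulr_algl scaleN1r.
Qed.
Lemma d0_0 : d0 0 = 0.
Proof. by rewrite -(scale0r 1) d0_Cst. Qed.
Lemma d0_1 : d0 1 = 0.
Proof. by rewrite -(scale1r 1) d0_Cst. Qed.

Lemma wedge0 : wedge 0 = 0.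
Proof. by have [_ wl _] := wedge_bimodule; rewrite -(scale0r 0) wl scale0r. Qed.
Lemma tens0l I (y : fbim A I) : (0 : Om1 lam) ⊗ y = 0.
Proof. by apply/ffunP=> i; rewrite !coefE mul0r. Qed.

Lemma d1_dr : d1 dr = 0.
Proof.
by rewrite /d1 !basisE d0_1 d0_0 scale0r !tens0l wedge0 !addr0.
Qed.
Lemma d1_v : d1 vr = dv.
Proof.
by rewrite /d1 !basisE d0_1 d0_0 scale1r !tens0l wedge0 !add0r.
Qed.

Lemma wedgeC_dr a : wedge (d0 a ⊗ dr) = - wedge (dr ⊗ d0 a).
Proof. by rewrite /wedge !tensE /= !crdE !simp01 scaleNr opprK. Qed.

Lemma wedgeC_v a :
  a *: dv + wedge (d0 a ⊗ vr) = ract dv a - wedge (vr ⊗ d0 a).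
Proof.
rewrite dvE ractZ bas_central !scalerA /wedge !tensE /= !crdE !simp01 d0_true.
rewrite -scalerDl -scalerBl; congr (_ *: _).
rewrite mulrN mulNr mulrDl mulrDr.
have canc (u w : A) : - (u + u) + (u - w) = - u - w.
  by rewrite opprD addrA subrK.
rewrite addrCA (opprD (d0 a false)) [RHS]addrCA opprB !canc; congr (_ + _).
exact: addrC.
Qed.

Lemma d1Mr w a : d1 (ract w a) = ract (d1 w) a - wedge (w ⊗ d0 a).
Proof.
have [wD wl wr] := wedge_bimodule.
pose P w := d1 (ract w a) = ract (d1 w) a - wedge (w ⊗ d0 a).
have PD u w' : P u -> P w' -> P (u + w').
  by rewrite /P ractD !d1D ractD tensDl wD opprD => -> ->; rewrite addrACA.
have PZ b u : P u -> P (b *: u).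
  rewrite /P => Pu; rewrite ractZ !d1Ml Pu tens_ract wr ractD ractZ tensZl wl.
  by rewrite scalerBr addrA.
rewrite (bas_coef w); apply: PD; apply: PZ; rewrite /P.
  by rewrite dr_central d1Ml d1_dr ract0 scaler0 addr0 add0r wedgeC_dr.
by rewrite vr_central d1Ml d1_v addrC wedgeC_v.
Qed.

Lemma d1_d0 a : d1 (d0 a) = 0.
Proof.
have [wD wl wr] := wedge_bimodule.
elim/bcm_gen_ind: a => [k||||a b ea eb|a b ea eb].
- by rewrite d0_Cst -(scale0r 0) d1Ml d0_0 tens0l wedge0 scale0r addr0.
- by rewrite d0_r d1_dr.
- rewrite d0_rV d1Ml d1_dr scaler0 addr0.
  have e : d0 (- (rV * rV)) true = 0.
    by rewrite d0N d0M d0_rV !crdE !simp01.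
  by rewrite /wedge !tensE /= e !crdE !simp01 scale0r.
- have : d1 vr = d1 (r *: dt) + d1 ((- t) *: dr).
    by rewrite -d1D scaleNr -vrE.
  rewrite (d1Ml r dt) (d1Ml (- t) dr) d1_v d1_dr scaler0 addr0 d0N d0_r d0_t.
  have -> : wedge (- dt ⊗ dr) = - wedge (dt ⊗ dr).
    by rewrite -scaleN1r tensZl wl scaleN1r.
  rewrite addrAC -/dv -[X in X = _]addr0.
  move=> /addrI/esym/(congr1 (fun y => rV *: y)).
  by rewrite scalerA bcrV_bcr scale1r scaler0.
- by rewrite d0D d1D ea eb addr0.
- by rewrite d0M d1D d1Mr d1Ml ea eb scaler0 addr0 ract0 sub0r addNr.
Qed.
End Calculus.

Section Connections.
Variables (K : fieldType) (lam : K).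
Local Notation A := (bcm lam).

(* K-linearity is expressed with the scalars [k%:A] of A. *)
Definition bimodule_connection (J : finType)
    (nabla : fbim A J -> fbim A (bool * J)%type)
    (sigma : fbim A (J * bool)%type -> fbim A (bool * J)%type) : Prop :=
  additive_map nabla /\
  (forall (k : K) w, nabla (k%:A *: w) = k%:A *: nabla w) /\
  bimodule_map sigma /\
  (forall a w, nabla (a *: w) = d0 a ⊗ w + a *: nabla w) /\
  (forall w a, nabla (ract w a) = ract (nabla w) a + sigma (w ⊗ d0 a)).

Variables (nabla : Om1 lam -> Om11 lam) (sigma : Om11 lam -> Om11 lam).

Definition sigma1 : Om111 lam -> Om111 lam := tmapl sigma.
Definition sigma2 (x : Om111 lam) : Om111 lam :=
  tassocV (tmapr sigma (tassoc x)).
Definition wedge1 : Om111 lam -> Om21 lam := tmapl (@wedge K lam).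
Definition wedge2 (x : Om111 lam) : Om12 lam :=
  tmapr (@wedge K lam) (tassoc x).

(* [tens_nabla w e] is w (x) nabla e; it is not A-balanced in (w, e). *)
Definition tens_nabla (w e : Om1 lam) : Om111 lam := tassocV (w ⊗ nabla e).

Definition torsion_free : Prop := forall w, wedge (nabla w) = d1 w.

Definition braided : Prop :=
  forall x, sigma1 (sigma2 (sigma1 x)) = sigma2 (sigma1 (sigma2 x)).

(* Below, a map given by a formula on elementary tensors is quantified
   existentially: it exists iff the formula is well defined, and is then unique
   since elementary tensors span. *)
Definition flat : Prop :=
  exists D : Om11 lam -> Om21 lam,
    [/\ additive_map D,
        forall w e, D (w ⊗ e) = d1 w ⊗ e - wedge1 (tens_nabla w e)
      & forall w, D (nabla w) = 0].

Definition extendable : Prop :=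
  exists E : Om12 lam -> Om21 lam,
    bimodule_map E /\
    forall w e z, E (w ⊗ wedge (e ⊗ z)) = wedge1 (sigma2 (sigma1 (w ⊗ e ⊗ z))).

Definition wedge_compatible : Prop :=
  exists (nablaO2 : Om2 lam -> Om12 lam) (sigmaO2 : Om21 lam -> Om12 lam),
    bimodule_connection nablaO2 sigmaO2 /\
    forall e w, nablaO2 (wedge (e ⊗ w)) =
      wedge2 (nabla e ⊗ w) + wedge2 (sigma1 (tens_nabla e w)).

Definition leibniz_compatible : Prop :=
  exists nabla2 : Om11 lam -> Om111 lam,
    [/\ additive_map nabla2,
        forall w e, nabla2 (w ⊗ e) = nabla w ⊗ e + sigma1 (tens_nabla w e)
      & forall x, nabla2 (sigma x) = sigma2 (nabla2 x)].

End Connections.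

Record coefs (K : Type) : Type := Coefs {
  alpha : K; beta : K; gamma : K; delta : K;
  alpha' : K; beta' : K; gamma' : K; delta' : K }.

Section Ansatz.
Variables (K : fieldType) (lam : K).

Definition comb (a b c d : K) : Om11 lam :=
  a%:A *: (vr lam ⊗ vr lam) + b%:A *: (vr lam ⊗ dr lam)
  + c%:A *: (dr lam ⊗ vr lam) + d%:A *: (dr lam ⊗ dr lam).

Definition ansatz_connection (c : coefs K)
    (nabla : Om1 lam -> Om11 lam) (sigma : Om11 lam -> Om11 lam) : Prop :=
  bimodule_connection nabla sigma /\
  nabla (dr lam) = bcrV lam *: comb (alpha c) (beta c) (gamma c) (delta c) /\
  nabla (vr lam) = bcrV lam *: comb (alpha' c) (beta' c) (gamma' c) (delta' c) /\
  sigma (dr lam ⊗ dr lam) = dr lam ⊗ dr lam /\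
  sigma (vr lam ⊗ dr lam) = dr lam ⊗ vr lam /\
  sigma (dr lam ⊗ vr lam) =
    comb (lam * alpha c) (1 + lam * beta c) (lam * gamma c) (lam * delta c) /\
  sigma (vr lam ⊗ vr lam) =
    comb (1 + lam * alpha' c) (lam * beta' c) (lam * gamma' c) (lam * delta' c).

Definition torsion_free_braided (c : coefs K) : Prop :=
  exists nabla sigma,
    [/\ ansatz_connection c nabla sigma, torsion_free nabla & braided sigma].

(* delta' is free. *)
Definition family_i (c : coefs K) : Prop :=
  [/\ alpha c = 0, beta c = 0 & gamma c = 0] /\
  [/\ alpha' c = 0, beta' c = 0, delta c = 2 & gamma' c = 2].

Definition family_ii (c : coefs K) : Prop :=
  [/\ alpha c = 0, beta c = 0, gamma c = 0 & delta c = 0] /\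
  [/\ alpha' c = 0, delta' c = 0, - beta' c = 1 & gamma' c = 1].

Definition sigma_i (d' : K) (sigma : Om11 lam -> Om11 lam) : Prop :=
  sigma (dr lam ⊗ vr lam) =
    vr lam ⊗ dr lam + (2 * lam)%:A *: (dr lam ⊗ dr lam) /\
  sigma (vr lam ⊗ vr lam) =
    vr lam ⊗ vr lam + (2 * lam)%:A *: (dr lam ⊗ vr lam)
    + (lam * d')%:A *: (dr lam ⊗ dr lam).

Definition sigma_ii (sigma : Om11 lam -> Om11 lam) : Prop :=
  sigma (dr lam ⊗ vr lam) = vr lam ⊗ dr lam /\
  sigma (vr lam ⊗ vr lam) =
    vr lam ⊗ (vr lam - lam%:A *: dr lam) + lam%:A *: (dr lam ⊗ vr lam).

End Ansatz.

Section Limit.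
Variable K : numFieldType.
Local Open Scope classical_set_scope.

Definition near_zero (P : K -> Prop) : Prop := \forall lam \near 0^', P lam.

Definition finite_limit (f : K -> K) : Prop :=
  exists l : K, f lam @[lam --> 0^'] --> l.

Definition all_coefs (P : (K -> K) -> Prop) (c : K -> coefs K) : Prop :=
  P (fun lam => alpha (c lam)) /\ P (fun lam => beta (c lam)) /\
  P (fun lam => gamma (c lam)) /\ P (fun lam => delta (c lam)) /\
  P (fun lam => alpha' (c lam)) /\ P (fun lam => beta' (c lam)) /\
  P (fun lam => gamma' (c lam)) /\ P (fun lam => delta' (c lam)).

Definition classical_limit (c : K -> coefs K) : Prop :=
  all_coefs finite_limit c.

Definition continuous_family (c : K -> coefs K) : Prop :=
  all_coefs (fun f => forall lam : K, lam != 0 -> {for lam, continuous f}) c.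

End Limit.

Definition CC (R : realType) : numFieldType := (R[i])%C.

(* Main.v *)
Require Import Defs.
From HB Require Import structures.
From mathcomp Require Import all_boot all_order all_algebra.
From mathcomp Require Import all_classical all_reals all_analysis.
From mathcomp Require Import complex ring.

Set Implicit Arguments.
Unset Strict Implicit.
Unset Printing Implicit Defensive.

Import Order.TTheory GRing.Theory Num.Theory numFieldNormedType.Exports.

Local Open Scope ring_scope.

(** Since dr and v are central, a bimodule map between tensor powers of Omega^1
is determined by its values on the basis; in the ansatz, those values have
coefficients in the ground field K, so every such map acts on vectors of
constants [kvec u] by a matrix over K. The connection acts on them as 1/r times
a matrix over K, and the difference of the two sides of each condition
(torsion, curvature, Leibniz and wedge compatibility) is left A-linear, the
derivation terms cancelling ([leibniz_ext]). So every condition on (nabla,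
sigma) becomes a finite family of polynomial identities in lambda and the eight
coefficients: [torsion_freeP], [braidedP], [extendableP], [wedge_compatibleP],
[leibniz_compatibleP], [flatP]. Any coefficients do define an ansatz connection
([ansatz_exists]), because [a, 1/r] = lambda q when da = p dr + q v, which is
exactly the commutator that the prescribed sigma encodes.

Torsion freeness reads beta - gamma + lambda alpha = 0 and
beta' - gamma' + lambda alpha' = -2. The braid relation on dr (x) dr (x) v
contains alpha^2 (1 + lambda (alpha' + beta)) = 0. If alpha <> 0 then
lambda (alpha' + beta) = -1. If alpha = 0 then beta = gamma = 0, and
delta <> 0 forces family (i); if also delta = 0, then p = 1 + lambda alpha'
satisfies p (p - 1) (p + 1) = 0, and p = 1 gives family (ii). Hence the number
lambda (alpha' + beta), called [braid_index] below, is 0 exactly on the two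
families and -1 or -2 on every other solution
([torsion_free_braided_cases]).

A classical limit makes this index tend to 0; having finitely many possible
values, it vanishes near lambda = 0, and likewise gamma', which is 2 on family
(i) and 1 on family (ii), is eventually constant ([classification_near_zero]).
For a continuous family over all lambda <> 0, both functions are locally
constant, hence constant along each ray to the origin
([locally_constant_punctured], [classification_punctured]). *)

(** * Central bases and additive maps *)
Section FreeBimodules.
Variable A : nzRingType.
Implicit Types I J L : finType.

Lemma additive_map0 I J (f : fbim A I -> fbim A J) : additive_map f -> f 0 = 0.
Proof. by move=> fD; apply: (addrI (f 0)); rewrite -fD !addr0. Qed.

Lemma additive_map_sum I J T (f : fbim A I -> fbim A J) (F : T -> fbim A I)
    (s : seq T) :
  additive_map f -> f (\sum_(i <- s) F i) = \sum_(i <- s) f (F i).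
Proof. by move=> fD; apply: (big_morph f fD (additive_map0 fD)). Qed.

(** A first-order operator is determined on a basis by its symbol [D]: this
covers linear maps ([D] = 0) as well as connections and their prolongations. *)
Lemma leibniz_ext I J (D : A -> fbim A I -> fbim A J) f g :
  additive_map f -> additive_map g ->
  (forall a x, f (a *: x) = D a x + a *: f x) ->
  (forall a x, g (a *: x) = D a x + a *: g x) ->
  (forall i, f (bas A i) = g (bas A i)) -> f =1 g.
Proof.
move=> fD gD fl gl fg x.
rewrite [x in LHS]basE [x in RHS]basE !additive_map_sum //.
by apply: eq_bigr => i _; rewrite fl gl fg.
Qed.

Lemma bimodule_map_ext I J (f g : fbim A I -> fbim A J) :
  bimodule_map f -> bimodule_map g ->
  (forall i, f (bas A i) = g (bas A i)) -> f =1 g.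
Proof.
move=> [fD fl _] [gD gl _]; apply: (leibniz_ext (D := fun _ _ => 0)) => //.
- by move=> a x; rewrite fl add0r.
- by move=> a x; rewrite gl add0r.
Qed.

Lemma tens_span I J (P : fbim A (I * J)%type -> Prop) :
  P 0 -> (forall x y, P x -> P y -> P (x + y)) ->
  (forall w e, P (w ⊗ e)) -> forall x, P x.
Proof.
move=> P0 PD Pt x; rewrite [x]basE; apply: (big_ind P) => // -[i j] _.
by rewrite -tens_bas -tensZl.
Qed.

Lemma bimodule_map_sum4 I J (f : fbim A I -> fbim A J) a b c d x y z t :
  bimodule_map f -> f (a *: x + b *: y + c *: z + d *: t) =
  a *: f x + b *: f y + c *: f z + d *: f t.
Proof. by move=> [fD fl _]; rewrite !fD !fl. Qed.

Lemma bimodule_map_comp I J L (f : fbim A I -> fbim A J)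
    (g : fbim A J -> fbim A L) :
  bimodule_map f -> bimodule_map g -> bimodule_map (g \o f).
Proof.
move=> [fD fl fr] [gD gl gr]; split=> [x y|a x|a x] /=.
- by rewrite fD gD.
- by rewrite fl gl.
- by rewrite fr gr.
Qed.

Lemma tmapl_bimodule I J L (f : fbim A I -> fbim A L) :
  bimodule_map f -> bimodule_map (@tmapl A I J L f).
Proof.
move=> [fD fl fr]; split=> [x y|a x|a x]; apply/ffunP => p;
  rewrite ?(fDE, fZE, ractE) !ffunE -?(fDE, fZE, ractE) -?fD -?fl -?fr;
  by congr (f _ _); apply/ffunP => i; rewrite !ffunE.
Qed.

Lemma tmapr_bimodule I J L (f : fbim A J -> fbim A L) :
  bimodule_map f -> bimodule_map (@tmapr A I J L f).
Proof.
move=> [fD fl fr]; split=> [x y|a x|a x]; apply/ffunP => p;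
  rewrite ?(fDE, fZE, ractE) !ffunE -?(fDE, fZE, ractE) -?fD -?fl -?fr;
  by congr (f _ _); apply/ffunP => i; rewrite !ffunE.
Qed.

Lemma tassoc_bimodule I J L : bimodule_map (@tassoc A I J L).
Proof. by split=> [x y|a x|a x]; apply/ffunP => p; rewrite !ffunE. Qed.

Lemma tassocV_bimodule I J L : bimodule_map (@tassocV A I J L).
Proof. by split=> [x y|a x|a x]; apply/ffunP => p; rewrite !ffunE. Qed.

(** A choice of images of the central basis extends to a bimodule map as soon as
these images are themselves central; constants are. *)
Definition free_map I J (T : I -> fbim A J) (x : fbim A I) : fbim A J :=
  \sum_i x i *: T i.

Lemma free_map_bas I J (T : I -> fbim A J) i : free_map T (bas A i) = T i.
Proof.
rewrite /free_map (bigD1 i) //= big1 => [|j ji].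
  by rewrite basjE eqxx scale1r addr0.
by rewrite basjE (negbTE ji) scale0r.
Qed.

Lemma free_map_bimodule I J (T : I -> fbim A J) :
  (forall i a, ract (T i) a = a *: T i) -> bimodule_map (free_map T).
Proof.
move=> Tc; split=> [x y|a x|a x].
- by rewrite /free_map -big_split; apply: eq_bigr => i _; rewrite fDE scalerDl.
- by rewrite /free_map scaler_sumr; apply: eq_bigr => i _; rewrite fZE scalerA.
- rewrite /free_map (big_morph (fun y => ract y a) (fun y z => ractD y z a) (ract0 _ _)).
  by apply: eq_bigr => i _; rewrite ractE ractZ Tc scalerA.
Qed.

Lemma tens0x I J (y : fbim A J) : (0 : fbim A I) ⊗ y = 0.
Proof. by apply/ffunP => p; rewrite !ffunE mul0r. Qed.

Lemma tensx0 I J (x : fbim A I) : x ⊗ (0 : fbim A J) = 0.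
Proof. by apply/ffunP => p; rewrite !ffunE mulr0. Qed.

Lemma tensNl I J (x : fbim A I) (y : fbim A J) : (- x) ⊗ y = - (x ⊗ y).
Proof. by apply/ffunP => p; rewrite !ffunE mulNr. Qed.

End FreeBimodules.

(** * Vectors of constants *)
Section Constants.
Variables (K : fieldType) (lam : K).
Local Notation A := (bcm lam).
Implicit Types I J L : finType.

Definition kvec I (u : I -> K) : fbim A I := [ffun i => (u i)%:A].

Lemma eq_kvec I (u u' : I -> K) : u =1 u' -> kvec u = kvec u'.
Proof. by move=> e; apply/ffunP => i; rewrite !ffunE e. Qed.

Lemma kvec_inj I (u u' : I -> K) : kvec u = kvec u' -> u =1 u'.
Proof.
move=> /ffunP e i; have := e i; rewrite !ffunE => /eqP.
rewrite -subr_eq0 -scalerBl scaler_eq0 oner_eq0 orbF subr_eq0.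
by move/eqP.
Qed.

Lemma bas_kvec I (i : I) : bas A i = kvec (fun j => (j == i)%:R).
Proof. by apply/ffunP => j; rewrite !ffunE; case: eqP; rewrite ?scale1r ?scale0r. Qed.

Lemma kvec_central I (u : I -> K) a : ract (kvec u) a = a *: kvec u.
Proof. by apply/ffunP => i; rewrite !ffunE mulr_algl mulr_algr. Qed.

Lemma kvec0 I : kvec (fun _ : I => 0) = 0.
Proof. by apply/ffunP => i; rewrite !ffunE scale0r. Qed.

Lemma kvecD I (u u' : I -> K) : kvec (fun i => u i + u' i) = kvec u + kvec u'.
Proof. by apply/ffunP => i; rewrite !ffunE scalerDl. Qed.

Lemma kvecN I (u : I -> K) : kvec (fun i => - u i) = - kvec u.
Proof. by apply/ffunP => i; rewrite !ffunE scaleNr. Qed.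

Lemma kvecZ I k (u : I -> K) : kvec (fun i => k * u i) = k%:A *: kvec u.
Proof. by apply/ffunP => i; rewrite !ffunE mulr_algl scalerA. Qed.

Lemma tens_kvec I J (u : I -> K) (u' : J -> K) :
  kvec u ⊗ kvec u' = kvec (fun p => u p.1 * u' p.2).
Proof. by apply/ffunP => p; rewrite !ffunE mulr_algl scalerA. Qed.

Definition on_kvec I J (f : fbim A I -> fbim A J) (F : (I -> K) -> (J -> K)) :=
  forall u, f (kvec u) = kvec (F u).

Definition left_factor I J L (F : (I -> K) -> (L -> K)) (u : I * J -> K) (p : L * J) : K :=
  F (fun i => u (i, p.2)) p.1.
Definition right_factor I J L (F : (J -> K) -> (L -> K)) (u : I * J -> K) (p : I * L) : K :=
  F (fun j => u (p.1, j)) p.2.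
Definition reassoc I J L (u : I * J * L -> K) (p : I * (J * L)) : K :=
  u (p.1, p.2.1, p.2.2).
Definition reassocV I J L (u : I * (J * L) -> K) (p : I * J * L) : K :=
  u (p.1.1, (p.1.2, p.2)).

Lemma on_kvec_left I J L f F :
  on_kvec f F -> on_kvec (@tmapl A I J L f) (left_factor F).
Proof.
move=> fF u; apply/ffunP => p; rewrite !ffunE.
rewrite (_ : [ffun i => _] = kvec (fun i => u (i, p.2))) ?fF ?ffunE //.
by apply/ffunP => i; rewrite !ffunE.
Qed.

Lemma on_kvec_right I J L f F :
  on_kvec f F -> on_kvec (@tmapr A I J L f) (right_factor F).
Proof.
move=> fF u; apply/ffunP => p; rewrite !ffunE.
rewrite (_ : [ffun i => _] = kvec (fun j => u (p.1, j))) ?fF ?ffunE //.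
by apply/ffunP => i; rewrite !ffunE.
Qed.

Lemma on_kvec_reassoc I J L : on_kvec (@tassoc A I J L) (@reassoc I J L).
Proof. by move=> u; apply/ffunP => p; rewrite !ffunE. Qed.

Lemma on_kvec_reassocV I J L : on_kvec (@tassocV A I J L) (@reassocV I J L).
Proof. by move=> u; apply/ffunP => p; rewrite !ffunE. Qed.

(** Bases consist of constant vectors, so a bimodule map is known from its
restriction to the constants. *)
Lemma kvec_ext I J (f g : fbim A I -> fbim A J) :
  bimodule_map f -> bimodule_map g ->
  (forall u, f (kvec u) = g (kvec u)) -> f =1 g.
Proof.
by move=> bf bg fg; apply: bimodule_map_ext => // i; rewrite bas_kvec.
Qed.

(** The order of arguments is that of the coefficients in [comb]: v v, v dr,
dr v, dr dr, where [true] stands for v and [false] for dr. *)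
Definition vec4 (a b c d : K) (p : bool * bool) : K :=
  match p with
  | (true, true) => a | (true, false) => b
  | (false, true) => c | (false, false) => d
  end.

Lemma comb_kvec a b c d : comb lam a b c d = kvec (vec4 a b c d).
Proof.
rewrite /comb !tens_bas !bas_kvec -!kvecZ -!kvecD; apply: eq_kvec.
by case=> [[] []] /=; ring.
Qed.

Definition wedgeK (u : bool * bool -> K) (_ : unit) : K :=
  u (true, false) - u (false, true) + lam * u (true, true).

Lemma on_kvec_wedge : on_kvec (@wedge K lam) wedgeK.
Proof.
move=> u; apply/ffunP; case; rewrite /wedge !ffunE mulr1 mulr_algr scalerA.
by rewrite scalerDl scalerBl.
Qed.

Lemma d1_kvec (u : bool -> K) :
  d1 (kvec u) = bcrV lam *: kvec (fun _ : unit => - (2 * u true)).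
Proof.
rewrite /d1 !ffunE !d0_Cst dvE !tens0l wedge0 !add0r.
apply/ffunP; case; rewrite !ffunE /= mulr1 mulr_algl mulr_algr scalerN scaleNr.
by congr (- _); rewrite scalerDr -scalerDl -mulr2n mulr_natl.
Qed.

End Constants.

(** * Prolongations of a bimodule connection *)
Section GeneralConnection.
Variables (K : fieldType) (lam : K).
Local Notation A := (bcm lam).
Variables (nabla : Om1 lam -> Om11 lam) (sigma : Om11 lam -> Om11 lam).
Hypothesis conn : bimodule_connection nabla sigma.

Lemma connD : additive_map nabla. Proof. by have [h _] := conn. Qed.
Lemma connK k w : nabla (k%:A *: w) = k%:A *: nabla w.
Proof. by have [_ [-> _]] := conn. Qed.
Lemma conn_bimod : bimodule_map sigma. Proof. by have [_ [_ [h _]]] := conn. Qed.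
Lemma connZ a w : nabla (a *: w) = d0 a ⊗ w + a *: nabla w.
Proof. by have [_ [_ [_ [-> _]]]] := conn. Qed.
Lemma connR w a : nabla (ract w a) = ract (nabla w) a + sigma (w ⊗ d0 a).
Proof. by have [_ [_ [_ [_ ->]]]] := conn. Qed.

Lemma sigma1_bimod : bimodule_map (sigma1 sigma).
Proof. exact: tmapl_bimodule conn_bimod. Qed.

Lemma sigma2_bimod : bimodule_map (sigma2 sigma).
Proof.
exact: bimodule_map_comp (bimodule_map_comp (@tassoc_bimodule A _ _ _)
  (tmapr_bimodule bool conn_bimod)) (@tassocV_bimodule A _ _ _).
Qed.

Lemma wedge1_bimod : bimodule_map (@wedge1 K lam).
Proof. exact/tmapl_bimodule/wedge_bimodule. Qed.

Lemma wedge2_bimod : bimodule_map (@wedge2 K lam).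
Proof.
exact: bimodule_map_comp (@tassoc_bimodule A _ _ _)
  (tmapr_bimodule bool (@wedge_bimodule K lam)).
Qed.

Lemma tassocV_tens (x y z : Om1 lam) : tassocV (x ⊗ (y ⊗ z)) = x ⊗ y ⊗ z.
Proof. by rewrite -tassoc_tens tassocK. Qed.

Lemma tens_nablaDl w w' e :
  tens_nabla nabla (w + w') e = tens_nabla nabla w e + tens_nabla nabla w' e.
Proof. by rewrite /tens_nabla tensDl; have [-> _ _] := @tassocV_bimodule A bool bool bool. Qed.

Lemma tens_nablaDr w e e' :
  tens_nabla nabla w (e + e') = tens_nabla nabla w e + tens_nabla nabla w e'.
Proof.
by rewrite /tens_nabla connD tensDr; have [-> _ _] := @tassocV_bimodule A bool bool bool.
Qed.

Lemma tens_nablaZl a w e : tens_nabla nabla (a *: w) e = a *: tens_nabla nabla w e.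
Proof. by rewrite /tens_nabla tensZl; have [_ -> _] := @tassocV_bimodule A bool bool bool. Qed.

Lemma tens_nablaZr w a e :
  tens_nabla nabla w (a *: e) =
  w ⊗ d0 a ⊗ e + tens_nabla nabla (ract w a) e.
Proof.
rewrite /tens_nabla connZ tensDr tens_balanced.
by have [-> _ _] := @tassocV_bimodule A bool bool bool; rewrite tassocV_tens.
Qed.

Lemma wedge2_tens (w e z : Om1 lam) : wedge2 (w ⊗ e ⊗ z) = w ⊗ wedge (e ⊗ z).
Proof. by rewrite /wedge2 tassoc_tens; apply: tmapr_tens (@wedge_bimodule K lam). Qed.

(** The failure of id (x) nabla to be balanced, w (x) da (x) e, is compensated
after applying sigma to the first two factors by the right Leibniz rule of
nabla. *)
Lemma nabla2_exists : exists N : Om11 lam -> Om111 lam,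
  additive_map N /\
  forall w e, N (w ⊗ e) = nabla w ⊗ e + sigma1 sigma (tens_nabla nabla w e).
Proof.
have [s1D s1l s1r] := sigma1_bimod.
pose f w e := nabla w ⊗ e + sigma1 sigma (tens_nabla nabla w e).
have [||| N [ND Nf _]] := @tens_universal A bool bool (Om111 lam) f.
- by move=> w w' e; rewrite /f connD tensDl tens_nablaDl s1D addrACA.
- by move=> w w' e; rewrite /f tensDr tens_nablaDr s1D addrACA.
- move=> w a e; rewrite /f tens_nablaZr s1D connR tensDl tens_balanced -addrA.
  by rewrite /sigma1 (tmapl_tens _ _ conn_bimod).
by exists N; split.
Qed.

Section Nabla2.
Variable N : Om11 lam -> Om111 lam.
Hypothesis (ND : additive_map N)
  (Nt : forall w e, N (w ⊗ e) = nabla w ⊗ e + sigma1 sigma (tens_nabla nabla w e)).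

Lemma nabla2Z a x : N (a *: x) = tassocV (d0 a ⊗ x) + a *: N x.
Proof.
have [s1D s1l s1r] := sigma1_bimod.
have [aD al ar] := @tassocV_bimodule A bool bool bool.
elim/tens_span: x => [|x y ex ey|w e].
- rewrite scaler0 (additive_map0 ND) scaler0 addr0.
  by rewrite tensx0 (additive_map0 aD).
- by rewrite scalerDr !ND ex ey tensDr aD scalerDr addrACA.
- rewrite -tensZl !Nt connZ tens_nablaZl s1l tensDl tensZl tassocV_tens.
  by rewrite scalerDr addrA.
Qed.

Lemma nabla2R x a : N (ract x a) = ract (N x) a + sigma1 sigma (sigma2 sigma (x ⊗ d0 a)).
Proof.
have [s1D s1l s1r] := sigma1_bimod.
have [s2D s2l s2r] := sigma2_bimod.
elim/tens_span: x => [|x y ex ey|w e].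
- by rewrite ract0 (additive_map0 ND) ract0 tens0x (additive_map0 s2D) (additive_map0 s1D) addr0.
- by rewrite ractD !ND ex ey tensDl s2D s1D ractD addrACA.
- rewrite -tens_ract !Nt tens_ract ractD -addrA; congr (_ + _).
  rewrite -s1r -s1D; congr (sigma1 _ _).
  rewrite /sigma2 tassoc_tens (tmapr_tens _ _ conn_bimod).
  have [aD al ar] := @tassocV_bimodule A bool bool bool.
  by rewrite /tens_nabla connR tensDr aD tens_ract ar.
Qed.
End Nabla2.

(** Balanced for the same reason, with the right Leibniz rule
d(w a) = (dw) a - w /\ da. *)
Lemma curvature_exists : exists D : Om11 lam -> Om21 lam,
  additive_map D /\
  forall w e, D (w ⊗ e) = d1 w ⊗ e - wedge1 (tens_nabla nabla w e).
Proof.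
have [w1D w1l w1r] := wedge1_bimod.
pose f w e := d1 w ⊗ e - wedge1 (tens_nabla nabla w e).
have [||| D [DD Df _]] := @tens_universal A bool bool (Om21 lam) f.
- by move=> w w' e; rewrite /f d1D tensDl tens_nablaDl w1D opprD addrACA.
- by move=> w w' e; rewrite /f tensDr tens_nablaDr w1D opprD addrACA.
- move=> w a e; rewrite /f tens_nablaZr w1D d1Mr tensDl tens_balanced -addrA.
  rewrite /wedge1 (tmapl_tens _ _ (@wedge_bimodule K lam)) opprD.
  by rewrite tensNl.
by exists D; split.
Qed.

Section Curvature.
Variable D : Om11 lam -> Om21 lam.
Hypothesis (DD : additive_map D)
  (Dt : forall w e, D (w ⊗ e) = d1 w ⊗ e - wedge1 (tens_nabla nabla w e)).

Lemma curvature_opZ a x : D (a *: x) = wedge1 (tassocV (d0 a ⊗ x)) + a *: D x.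
Proof.
have [w1D w1l w1r] := wedge1_bimod.
have [aD al ar] := @tassocV_bimodule A bool bool bool.
elim/tens_span: x => [|x y ex ey|w e].
- rewrite scaler0 (additive_map0 DD) scaler0 addr0.
  by rewrite tensx0 (additive_map0 aD) (additive_map0 w1D).
- by rewrite scalerDr !DD ex ey tensDr aD w1D scalerDr addrACA.
- rewrite -tensZl !Dt d1Ml tens_nablaZl w1l tensDl tensZl tassocV_tens.
  rewrite /wedge1 (tmapl_tens _ _ (@wedge_bimodule K lam)).
  by rewrite scalerBr addrA.
Qed.

Lemma curvatureZ a w : D (nabla (a *: w)) = a *: D (nabla w).
Proof.
by rewrite connZ DD Dt d1_d0 curvature_opZ addrA tens0x sub0r addNr add0r.
Qed.
End Curvature.

Lemma torsionZ a w : wedge (nabla (a *: w)) = wedge (d0 a ⊗ w) + a *: wedge (nabla w).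
Proof. by have [wD wl _] := @wedge_bimodule K lam; rewrite connZ wD wl. Qed.

End GeneralConnection.

(** The section vol |-> v (x) dr of the wedge is a bimodule map because v (x) dr
is central. Maps that descend through the wedge are obtained by composing with
it, so that being well defined becomes an equality of maps upstairs. *)
Section WedgeSection.
Variables (K : fieldType) (lam : K).
Local Notation A := (bcm lam).

Definition lift2 (y : Om2 lam) : Om11 lam := y tt *: (vr lam ⊗ dr lam).

Lemma lift2_bimod : bimodule_map lift2.
Proof.
split=> [x y|a x|a x]; rewrite /lift2.
- by rewrite fDE scalerDl.
- by rewrite fZE scalerA.
- by rewrite ractE ractZ -tens_ract dr_central -tens_balanced vr_central tensZl scalerA.
Qed.

Lemma wedge_lift2 y : wedge (lift2 y) = y.
Proof.
have [_ wl _] := @wedge_bimodule K lam.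
by apply/ffunP; case; rewrite /lift2 wl wedge_v_dr fZE basjE mulr1.
Qed.

Definition lift2K (u : unit -> K) : bool * bool -> K := vec4 0 (u tt) 0 0.

Lemma on_kvec_lift2 : on_kvec lift2 lift2K.
Proof.
move=> u; rewrite /lift2 ffunE.
by apply: om11P; rewrite fZE tensE /= !basisE !simp01 ffunE /= ?scale0r.
Qed.
End WedgeSection.

(** * The ansatz on constants *)
Section Ansatz.
Variables (K : fieldType) (lam : K) (c : coefs K).
Local Notation A := (bcm lam).

Definition nabla_dr_coefs : bool * bool -> K := vec4 (alpha c) (beta c) (gamma c) (delta c).
Definition nabla_v_coefs : bool * bool -> K := vec4 (alpha' c) (beta' c) (gamma' c) (delta' c).

Definition nablaK (u : bool -> K) (p : bool * bool) : K :=
  u false * nabla_dr_coefs p + u true * nabla_v_coefs p.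

Definition sigmaK (u : bool * bool -> K) (p : bool * bool) : K :=
  match p with
  | (true, true) =>
      lam * alpha c * u (false, true) + (1 + lam * alpha' c) * u (true, true)
  | (true, false) =>
      (1 + lam * beta c) * u (false, true) + lam * beta' c * u (true, true)
  | (false, true) => u (true, false)
      + lam * gamma c * u (false, true) + lam * gamma' c * u (true, true)
  | (false, false) => u (false, false)
      + lam * delta c * u (false, true) + lam * delta' c * u (true, true)
  end.

Definition sigma1K : (bool * bool * bool -> K) -> bool * bool * bool -> K := left_factor sigmaK.
Definition sigma2K (u : bool * bool * bool -> K) : bool * bool * bool -> K :=
  reassocV (right_factor sigmaK (reassoc u)).
Definition wedge1K : (bool * bool * bool -> K) -> unit * bool -> K := left_factor (wedgeK lam).
Definition wedge2K (u : bool * bool * bool -> K) : bool * unit -> K :=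
  right_factor (wedgeK lam) (reassoc u).
Definition tens_nablaK (u : bool * bool -> K) : bool * bool * bool -> K :=
  reassocV (right_factor nablaK u).
Definition nabla2K (u : bool * bool -> K) (p : bool * bool * bool) : K :=
  left_factor nablaK u p + sigma1K (tens_nablaK u) p.

Lemma on_kvec_wedge1 : on_kvec (@wedge1 K lam) wedge1K.
Proof. exact/on_kvec_left/on_kvec_wedge. Qed.

Lemma on_kvec_wedge2 : on_kvec (@wedge2 K lam) wedge2K.
Proof. by move=> u; rewrite /wedge2 on_kvec_reassoc (on_kvec_right (@on_kvec_wedge K lam)). Qed.

(** The only condition to check on the freely extended maps is the right Leibniz
rule on a basis element e: with da = p dr + q v it says that
[a, 1/r] N = q (sigma(e (x) v) - v (x) e), where nabla e = (1/r) N, and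
[a, 1/r] = lambda q. *)
Lemma ansatz_exists : exists nabla sigma, @ansatz_connection K lam c nabla sigma.
Proof.
pose n i := if i then nabla_v_coefs else nabla_dr_coefs.
pose N i : Om11 lam := bcrV lam *: kvec lam (n i).
pose sigma : Om11 lam -> Om11 lam :=
  free_map (fun p => kvec lam (sigmaK (fun q => (q == p)%:R))).
pose nabla (w : Om1 lam) : Om11 lam := \sum_i (d0 (w i) ⊗ bas A i + w i *: N i).
have bs : bimodule_map sigma.
  by apply: free_map_bimodule => i a; rewrite kvec_central.
have Sval p x : (forall q, sigmaK (fun q => (q == p)%:R) q = x q) ->
    sigma (bas A p) = kvec lam x.
  by move=> e; rewrite /sigma free_map_bas; apply: eq_kvec.
have s_dr i : sigma (bas A i ⊗ dr lam) = dr lam ⊗ bas A i.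
  rewrite !tens_bas [RHS]bas_kvec; apply: Sval.
  by case: i; case=> [[] []]; rewrite /sigmaK /=; ring.
have s_v i : sigma (bas A i ⊗ vr lam) = vr lam ⊗ bas A i + lam%:A *: kvec lam (n i).
  rewrite !tens_bas [bas A (_, _) in RHS]bas_kvec -kvecZ -kvecD; apply: Sval.
  by case: i; case=> [[] []]; rewrite /sigmaK /=; ring.
have [sD sl sr] := bs.
have nD : additive_map nabla.
  move=> x y; rewrite /nabla -big_split; apply: eq_bigr => i _ /=.
  by rewrite fDE d0D tensDl scalerDl addrACA.
have nZ a w : nabla (a *: w) = d0 a ⊗ w + a *: nabla w.
  have -> : d0 a ⊗ w = \sum_i d0 a ⊗ (w i *: bas A i).
    by rewrite {1}[w]basE (big_morph _ (tensDr (d0 a)) (tensx0 _ _)).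
  rewrite /nabla scaler_sumr -big_split; apply: eq_bigr => i _ /=.
  by rewrite fZE d0M tensDl tens_balanced scalerDr tensZl -addrA -scalerA.
have nB i : nabla (bas A i) = N i.
  rewrite /nabla (bigD1 i) //= big1 => [|j ji].
    by rewrite basjE eqxx d0_1 tens0x add0r scale1r addr0.
  by rewrite basjE (negbTE ji) d0_0 tens0x scale0r addr0.
have nR w a : nabla (ract w a) = ract (nabla w) a + sigma (w ⊗ d0 a).
  pose P w := nabla (ract w a) = ract (nabla w) a + sigma (w ⊗ d0 a).
  have PD x y : P x -> P y -> P (x + y).
    by rewrite /P ractD !nD ractD tensDl sD => -> ->; rewrite addrACA.
  have PZ b x : P x -> P (b *: x).
    rewrite /P ractZ !nZ => ->; rewrite ractD ractZ tensZl sl scalerDr tens_ract.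
    by rewrite addrA.
  rewrite (bas_coef w); suff Pb i : P (bas A i) by apply: PD; apply: PZ; apply: Pb.
  rewrite /P bas_central nZ nB {1}(bas_coef (d0 a)) [in sigma _](bas_coef (d0 a)).
  rewrite tensDl tensDr -!tens_balanced !bas_central !tensZl sD !sl s_dr s_v.
  rewrite /N ractZ kvec_central !scalerA scalerDr scalerA d0_true scalerBl.
  by rewrite [RHS]addrC -[RHS]addrA -(addrA (_ *: (vr lam ⊗ _))) subrK addrA.
exists nabla, sigma; split; first by split => //; split => // k w; rewrite nZ d0_Cst tens0x add0r.
rewrite !nB !s_dr !s_v !comb_kvec; do 4!split=> //.
split; rewrite tens_bas bas_kvec -kvecZ -kvecD; apply: eq_kvec.
  by case=> [[] []] /=; ring.
by case=> [[] []] /=; ring.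
Qed.

End Ansatz.

(** * Conditions on the connection as identities over the ground field *)
Section AnsatzConnection.
Variables (K : fieldType) (lam : K) (c : coefs K).
Local Notation A := (bcm lam).
Local Notation rV := (bcrV lam).
Variables (nabla : Om1 lam -> Om11 lam) (sigma : Om11 lam -> Om11 lam).
Hypothesis ansatz : ansatz_connection c nabla sigma.

Let conn : bimodule_connection nabla sigma := proj1 ansatz.

Lemma on_kvec_sigma : on_kvec sigma (sigmaK lam c).
Proof.
have [_ [_ [_ [sff [stf [sft stt]]]]]] := ansatz.
move=> u; rewrite (_ : kvec lam u = comb lam (u (true, true)) (u (true, false))
  (u (false, true)) (u (false, false))); last first.
  by rewrite comb_kvec; apply: eq_kvec; case=> [[] []].
rewrite [in LHS]/comb (bimodule_map_sum4 _ _ _ _ _ _ _ _ (conn_bimod conn))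
  sff stf sft stt !comb_kvec !tens_bas !bas_kvec.
rewrite -!kvecZ -!kvecD; apply: eq_kvec.
by case=> [[] []]; rewrite /sigmaK /=; ring.
Qed.

Lemma on_kvec_sigma1 : on_kvec (sigma1 sigma) (sigma1K lam c).
Proof. exact/on_kvec_left/on_kvec_sigma. Qed.

Lemma on_kvec_sigma2 : on_kvec (sigma2 sigma) (sigma2K lam c).
Proof.
by move=> u; rewrite /sigma2 on_kvec_reassoc (on_kvec_right on_kvec_sigma) on_kvec_reassocV.
Qed.

Lemma nabla_kvec u : nabla (kvec lam u) = rV *: kvec lam (nablaK c u).
Proof.
have [_ [n_dr [n_v _]]] := ansatz.
rewrite (_ : kvec lam u = (u false)%:A *: dr lam + (u true)%:A *: vr lam); last first.
  by rewrite {1}(bas_coef (kvec lam u)) !ffunE.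
have kC k x : k%:A *: (rV *: x) = rV *: (k%:A *: x) :> Om11 lam.
  by rewrite !scalerA mulr_algl mulr_algr.
rewrite (connD conn) !(connK conn) n_dr n_v !comb_kvec !kC.
by rewrite -scalerDr -!kvecZ -kvecD.
Qed.

Lemma tens_nabla_kvec u e : tens_nabla nabla (kvec lam u) (kvec lam e) =
  rV *: kvec lam (reassocV (fun p => u p.1 * nablaK c e p.2)).
Proof.
have [aD al ar] := @tassocV_bimodule A bool bool bool.
rewrite /tens_nabla nabla_kvec -tens_balanced kvec_central tensZl tens_kvec al.
by rewrite on_kvec_reassocV.
Qed.

Definition delta_vec (i j : bool) : K := (j == i)%:R.

Lemma kvec_split (u : bool * bool -> K) : kvec lam u =
  kvec lam (fun i => u (i, false)) ⊗ kvec lam (delta_vec false) +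
  kvec lam (fun i => u (i, true)) ⊗ kvec lam (delta_vec true).
Proof.
rewrite !tens_kvec -kvecD; apply: eq_kvec => -[i []] /=; rewrite /delta_vec /=; ring.
Qed.

Lemma nabla2_kvec (N : Om11 lam -> Om111 lam) u :
  additive_map N ->
  (forall w e, N (w ⊗ e) = nabla w ⊗ e + sigma1 sigma (tens_nabla nabla w e)) ->
  N (kvec lam u) = rV *: kvec lam (nabla2K lam c u).
Proof.
move=> ND Nt; have [sD sl _] := sigma1_bimod conn.
rewrite {1}kvec_split ND !Nt !tens_nabla_kvec !nabla_kvec !sl !on_kvec_sigma1.
rewrite !tensZl !tens_kvec -!scalerDr -!kvecD; congr (_ *: _); apply: eq_kvec.
rewrite /nabla2K /sigma1K /tens_nablaK /left_factor /reassocV /right_factor /sigmaK /nablaK /delta_vec.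
by case=> [[[] []] []] /=; ring.
Qed.

Definition curvatureK (u : bool * bool -> K) (p : unit * bool) : K :=
  - (2 * u (true, p.2)) - wedge1K lam (tens_nablaK c u) p.

Lemma curvature_kvec (D : Om11 lam -> Om21 lam) u :
  additive_map D ->
  (forall w e, D (w ⊗ e) = d1 w ⊗ e - wedge1 (tens_nabla nabla w e)) ->
  D (kvec lam u) = rV *: kvec lam (curvatureK u).
Proof.
move=> DD Dt; have [wD wl _] := @wedge1_bimod K lam.
rewrite {1}kvec_split DD !Dt !tens_nabla_kvec !d1_kvec !wl !on_kvec_wedge1.
rewrite !tensZl !tens_kvec -!scalerBr -!scalerDr -!kvecN -!kvecD.
congr (_ *: _); apply: eq_kvec.
rewrite /curvatureK /wedge1K /tens_nablaK /left_factor /reassocV /right_factor /wedgeK /nablaK /delta_vec.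
by case=> [[] []] /=; ring.
Qed.

Lemma torsion_freeP :
  torsion_free nabla <-> forall u i, wedgeK lam (nablaK c u) i = - (2 * u true).
Proof.
have [wD wl _] := @wedge_bimodule K lam.
have tfE u : wedge (nabla (kvec lam u)) = d1 (kvec lam u) <->
    forall i, wedgeK lam (nablaK c u) i = - (2 * u true).
  rewrite nabla_kvec wl on_kvec_wedge d1_kvec; split=> [|e]; last first.
    by congr (_ *: _); apply: eq_kvec.
  move/(congr1 (fun y => bcr lam *: y)); rewrite !scalerA bcr_bcrV !scale1r.
  exact: kvec_inj.
split=> [tf u|tf w]; first exact/tfE.
apply: (leibniz_ext (D := fun a w => wedge (d0 a ⊗ w))
  (f := fun w => wedge (nabla w)) (g := @d1 K lam)).
- by move=> x y; rewrite (connD conn) wD.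
- exact: d1D.
- exact: torsionZ conn.
- exact: d1Ml.
- by move=> i; rewrite bas_kvec; apply/tfE.
Qed.

Lemma braidedP : braided sigma <-> forall u p,
  sigma1K lam c (sigma2K lam c (sigma1K lam c u)) p =
  sigma2K lam c (sigma1K lam c (sigma2K lam c u)) p.
Proof.
have b1 := sigma1_bimod conn; have b2 := sigma2_bimod conn.
split=> [br u|br].
  by apply: (@kvec_inj K lam); rewrite -!(on_kvec_sigma1, on_kvec_sigma2).
apply: (kvec_ext (f := sigma1 sigma \o (sigma2 sigma \o sigma1 sigma))
  (g := sigma2 sigma \o (sigma1 sigma \o sigma2 sigma))) => [||u /=].
- exact: bimodule_map_comp (bimodule_map_comp b1 b2) b1.
- exact: bimodule_map_comp (bimodule_map_comp b2 b1) b2.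
- by rewrite !(on_kvec_sigma1, on_kvec_sigma2); apply: eq_kvec.
Qed.

(** Composing with the section turns the map to be constructed into an honest
bimodule map; it satisfies the required formula as soon as replacing the last
two factors by the lift of their wedge changes nothing. *)
Lemma extendableP :
  (forall u p, wedge1K lam (sigma2K lam c (sigma1K lam c
     (reassocV (right_factor (@lift2K K) (right_factor (wedgeK lam) (reassoc u)))))) p =
     wedge1K lam (sigma2K lam c (sigma1K lam c u)) p) ->
  extendable sigma.
Proof.
move=> ext; pose M := @wedge1 K lam \o (sigma2 sigma \o sigma1 sigma).
pose L (y : Om12 lam) : Om111 lam := tassocV (tmapr (@lift2 K lam) y).
have bM : bimodule_map M.
  exact: bimodule_map_comp (bimodule_map_comp (sigma1_bimod conn)
    (sigma2_bimod conn)) (@wedge1_bimod K lam).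
have bL : bimodule_map L.
  exact: bimodule_map_comp (tmapr_bimodule bool (@lift2_bimod K lam))
    (@tassocV_bimodule A _ _ _).
have MLE x : M (L (wedge2 x)) = M x.
  apply: (kvec_ext (f := M \o (L \o @wedge2 K lam)) (g := M)) x => [||u].
  - exact: bimodule_map_comp (bimodule_map_comp (@wedge2_bimod K lam) bL) bM.
  - by [].
  rewrite /M /L /wedge2 /= on_kvec_reassoc (on_kvec_right (@on_kvec_wedge K lam)).
  rewrite (on_kvec_right (@on_kvec_lift2 K lam)) on_kvec_reassocV.
  by rewrite !(on_kvec_sigma1, on_kvec_sigma2, on_kvec_wedge1); apply: eq_kvec.
exists (M \o L); split; first exact: bimodule_map_comp bL bM.
by move=> w e z; rewrite -[RHS]/(M _) -[RHS]MLE wedge2_tens.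
Qed.

(** The connection on Omega^2 is wedge nabla_2 lift. That it sends the wedge of x
to the wedge of nabla_2 x can be tested on constants since both sides have the
symbol x |-> da (x) wedge x. Its generalised braiding is obtained by lifting
in the same way the braiding sigma_1 sigma_2 of nabla_2. *)
Lemma wedge_compatibleP :
  (forall u p, wedge2K lam (nabla2K lam c (lift2K (wedgeK lam u))) p =
     wedge2K lam (nabla2K lam c u) p) ->
  wedge_compatible nabla sigma.
Proof.
move=> wc; have [N [ND Nt]] := nabla2_exists conn.
have NZ := nabla2Z conn ND Nt; have NR := nabla2R conn ND Nt.
have b1 := sigma1_bimod conn; have b2 := sigma2_bimod conn.
have bl := @lift2_bimod K lam; have bw := @wedge2_bimod K lam.
have [lD ll lr] := bl; have [w2D w2l w2r] := bw.
have [wD wl wr] := @wedge_bimodule K lam.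
pose nO (y : Om2 lam) : Om12 lam := wedge2 (N (lift2 y)).
pose sO : Om21 lam -> Om12 lam :=
  (@wedge2 K lam \o (sigma1 sigma \o sigma2 sigma)) \o @tmapl A _ bool _ (@lift2 K lam).
have wd a x : wedge2 (tassocV (d0 a ⊗ x)) = d0 a ⊗ wedge x.
  by rewrite /wedge2 tassocVK; apply/tmapr_tens/wedge_bimodule.
have nOZ a y : nO (a *: y) = d0 a ⊗ y + a *: nO y.
  by rewrite /nO ll NZ w2D w2l wd wedge_lift2.
have nOw x : nO (wedge x) = wedge2 (N x).
  apply: (leibniz_ext (D := fun a x => d0 a ⊗ wedge x)
    (f := fun x => nO (wedge x)) (g := fun x => wedge2 (N x))) => [z y|z y|a y|a y|i].
  - by rewrite /nO wD lD ND w2D.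
  - by rewrite ND w2D.
  - by rewrite wl nOZ.
  - by rewrite NZ w2D wd w2l.
  - rewrite bas_kvec on_kvec_wedge /nO on_kvec_lift2.
    rewrite (nabla2_kvec _ ND Nt) (nabla2_kvec _ ND Nt).
    by rewrite 2!w2l !on_kvec_wedge2; congr (_ *: _); apply: eq_kvec.
exists nO, sO; split; last by move=> e w; rewrite nOw Nt w2D.
split; first by move=> x y; rewrite /nO lD ND w2D.
split; first by move=> k w; rewrite nOZ d0_Cst tens0x add0r.
split.
  exact: bimodule_map_comp (tmapl_bimodule bool bl)
    (bimodule_map_comp (bimodule_map_comp b2 b1) bw).
split=> // y a.
by rewrite /nO lr NR w2D w2r /sO /= (tmapl_tens _ _ bl).
Qed.

(** Both nabla_2 sigma and sigma_2 nabla_2 have symbol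
x |-> da (x) sigma x. *)
Lemma leibniz_compatibleP :
  (forall u p, nabla2K lam c (sigmaK lam c u) p =
     sigma2K lam c (nabla2K lam c u) p) ->
  leibniz_compatible nabla sigma.
Proof.
move=> lc; have [N [ND Nt]] := nabla2_exists conn.
have NZ := nabla2Z conn ND Nt.
have [sD sl sr] := conn_bimod conn; have [s2D s2l s2r] := sigma2_bimod conn.
exists N; split=> // x.
apply: (leibniz_ext (D := fun a x => tassocV (d0 a ⊗ sigma x))
    (f := fun x => N (sigma x)) (g := fun x => sigma2 sigma (N x))) => [z y|z y|a y|a y|i].
- by rewrite sD ND.
- by rewrite ND s2D.
- by rewrite sl NZ.
- rewrite NZ s2D s2l; congr (_ + _).
  rewrite /sigma2 tassocVK; congr tassocV.
  by apply/tmapr_tens/(conn_bimod conn).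
- rewrite bas_kvec on_kvec_sigma !nabla2_kvec // s2l on_kvec_sigma2.
  by congr (_ *: _); apply: eq_kvec.
Qed.

(** The right-hand side of the hypothesis comes from d(1/r) = - r^-2 dr, all
other terms carrying r^-2 through the two factors 1/r. *)
Lemma flatP :
  (forall u p, curvatureK (nablaK c u) p =
     wedge1K lam (reassocV (fun q => delta_vec false q.1 * nablaK c u q.2)) p) ->
  flat nabla.
Proof.
move=> fl; have [D [DD Dt]] := curvature_exists conn.
exists D; split=> // w.
apply: (leibniz_ext (D := fun _ _ => 0)
    (f := fun w => D (nabla w)) (g := fun=> 0)) => [z y|z y|a y|a y|i].
- by rewrite (connD conn) DD.
- by rewrite addr0.
- by rewrite (curvatureZ conn DD Dt) add0r.
- by rewrite scaler0 addr0.
rewrite bas_kvec nabla_kvec (curvature_opZ DD Dt) curvature_kvec // d0_rV.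
have [aD al ar] := @tassocV_bimodule A bool bool bool.
have [w1D w1l w1r] := @wedge1_bimod K lam.
rewrite (_ : dr lam = kvec lam (delta_vec false)); last exact: bas_kvec.
rewrite tensZl tens_kvec al on_kvec_reassocV w1l on_kvec_wedge1.
rewrite scalerA scaleNr -scalerN -scalerDr -kvecN -kvecD.
rewrite -[RHS](scaler0 _ (rV * rV)) -(kvec0 lam); congr (_ *: _).
by apply: eq_kvec => p; rewrite fl addNr.
Qed.
End AnsatzConnection.

(** * The two families and the exceptional solutions *)
Ltac unfoldK := cbv beta iota delta [fst snd alpha beta gamma delta alpha'
  beta' gamma' delta' curvatureK nabla2K sigma1K sigma2K wedge1K wedge2K
  tens_nablaK left_factor right_factor reassoc reassocV sigmaK nablaK nabla_dr_coefs nabla_v_coefs vec4 wedgeK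
  lift2K delta_vec]; rewrite /=.

Section Classification.
Variables (K : fieldType) (lam : K).

Lemma family_iE (c : coefs K) : family_i c -> c = Coefs 0 0 0 2 0 0 2 (delta' c).
Proof.
by case: c => a b g d a' b' g' d' [/= [-> -> ->] [-> -> -> ->]].
Qed.

Lemma family_iiE (c : coefs K) : family_ii c -> c = Coefs 0 0 0 0 0 (- 1) 1 0.
Proof.
case: c => a b g d a' b' g' d' [/= [-> -> -> ->] [-> -> nb ->]].
by rewrite -nb opprK.
Qed.

Lemma sigmaK_i h : sigmaK lam (Coefs 0 0 0 2 0 0 2 h) = fun u p =>
  match p with
  | (true, true) => u (true, true)
  | (true, false) => u (false, true)
  | (false, true) => u (true, false) + 2 * lam * u (true, true)
  | (false, false) => u (false, false) + 2 * lam * u (false, true)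
                      + lam * h * u (true, true)
  end.
Proof.
by apply/funext => u; apply/funext => -[[] []]; rewrite /sigmaK /=; ring.
Qed.

Lemma nablaK_i (h : K) : nablaK (Coefs 0 0 0 2 0 0 2 h) = fun u p =>
  match p with
  | (true, _) => 0
  | (false, true) => 2 * u true
  | (false, false) => 2 * u false + h * u true
  end.
Proof.
apply/funext => u; apply/funext => p.
by rewrite /nablaK /nabla_dr_coefs /nabla_v_coefs; case: p => [[] []] /=; ring.
Qed.

Lemma sigmaK_ii : sigmaK lam (Coefs 0 0 0 0 0 (- 1) 1 0) = fun u p =>
  match p with
  | (true, true) => u (true, true)
  | (true, false) => u (false, true) - lam * u (true, true)
  | (false, true) => u (true, false) + lam * u (true, true)
  | (false, false) => u (false, false)
  end.
Proof.
by apply/funext => u; apply/funext => -[[] []]; rewrite /sigmaK /=; ring.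
Qed.

Lemma nablaK_ii : nablaK (Coefs 0 0 0 0 0 (- 1) 1 0 : coefs K) = fun u p =>
  match p with
  | (true, true) | (false, false) => 0
  | (true, false) => - u true
  | (false, true) => u true
  end.
Proof.
apply/funext => u; apply/funext => p.
by rewrite /nablaK /nabla_dr_coefs /nabla_v_coefs; case: p => [[] []] /=; ring.
Qed.

Lemma family_properties c nabla sigma : family_i c \/ family_ii c ->
  @ansatz_connection K lam c nabla sigma ->
  torsion_free nabla /\ braided sigma /\ extendable sigma /\
  wedge_compatible nabla sigma /\ leibniz_compatible nabla sigma /\ flat nabla.
Proof.
move=> fam ans.
split; [|split; [|split; [|split; [|split]]]].
- apply/(torsion_freeP ans) => u i.
  by case: fam => [/family_iE|/family_iiE] ->; rewrite ?nablaK_i ?nablaK_ii; unfoldK; ring.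
- apply/(braidedP ans) => u p; rewrite /sigma1K /sigma2K.
  by case: fam => [/family_iE|/family_iiE] ->; rewrite ?(sigmaK_i, sigmaK_ii);
    case: p => [[[] []] []]; unfoldK; ring.
- apply: (extendableP ans) => u p; rewrite /sigma1K /sigma2K.
  by case: fam => [/family_iE|/family_iiE] ->; rewrite ?(sigmaK_i, sigmaK_ii);
    case: p => [[] []]; unfoldK; ring.
- apply: (wedge_compatibleP ans) => u p; rewrite /nabla2K /sigma1K /tens_nablaK.
  by case: fam => [/family_iE|/family_iiE] ->;
    rewrite ?(sigmaK_i, sigmaK_ii, nablaK_i, nablaK_ii);
    case: p => [[] []]; unfoldK; ring.
- apply: (leibniz_compatibleP ans) => u p.
  rewrite /nabla2K /sigma1K /sigma2K /tens_nablaK.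
  by case: fam => [/family_iE|/family_iiE] ->;
    rewrite ?(sigmaK_i, sigmaK_ii, nablaK_i, nablaK_ii);
    case: p => [[[] []] []]; unfoldK; ring.
- apply: (flatP ans) => u p; rewrite /curvatureK /tens_nablaK.
  by case: fam => [/family_iE|/family_iiE] ->; rewrite ?(nablaK_i, nablaK_ii);
    case: p => [[] []]; unfoldK; ring.
Qed.

(** The three cases are separated by lambda (alpha' + beta), which is 0 on both
families. The braid relation is tested on basis vectors; below, the first
argument of [br] is the basis vector and the second one the coordinate. *)
Lemma torsion_free_braided_cases c : lam != 0 -> 2 != 0 :> K ->
  torsion_free_braided lam c ->
  [\/ family_i c \/ family_ii c, lam * (alpha' c + beta c) = - 1
    | lam * (alpha' c + beta c) = - 2].
Proof.
move=> l0 two0 [nabla [sigma [ans /(torsion_freeP ans) tf /(braidedP ans) br]]].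
have tf0 := tf (delta_vec K false) tt; have {tf} tf1 := tf (delta_vec K true) tt.
pose e (q : bool * bool * bool) p : K := (p == q)%:R.
have {}br q p : sigma1K lam c (sigma2K lam c (sigma1K lam c (e q))) p -
  sigma2K lam c (sigma1K lam c (sigma2K lam c (e q))) p = 0 by rewrite br subrr.
case: c {ans} tf0 tf1 br => a b g d a' b' g' d'.
rewrite /wedgeK /nablaK /delta_vec /= !mul0r !mul1r !addr0 !add0r mulr0 mulr1 oppr0.
move=> tf0 tf1 br.
have zeroM (x y : K) : x * y = 0 -> x = 0 \/ y = 0.
  by move/eqP; rewrite mulf_eq0 => /orP[] /eqP; [left|right].
have lam0 (x : K) : lam * x = 0 -> x = 0.
  by case/zeroM => // /eqP; rewrite (negbTE l0).
have two_0 (x : K) : 2 * x = 0 -> x = 0.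
  by case/zeroM => // /eqP; rewrite (negbTE two0).
have sq0 (x : K) : x * x = 0 -> x = 0 by case/zeroM.
have e1 : (lam * a) * (lam * a) * (1 + lam * (a' + b)) = 0.
  by rewrite -oppr0 -(br (false, false, true) (true, true, true)) /e; unfoldK; ring.
have [/sq0/lam0 a0|e1'] := zeroM _ _ e1; last first.
  by apply: Or32; apply/eqP; rewrite -subr_eq0 opprK addrC e1'.
subst a; have bg : g = b by apply/eqP; rewrite -subr_eq0 -oppr_eq0 -{}tf0; apply/eqP; ring.
subst g => {e1 tf0}.
have b0 : b = 0.
  apply/lam0/sq0/two_0.
  rewrite -oppr0 -(br (false, false, true) (false, false, true)) /e; unfoldK; ring.
subst b.
have a'd : a' * d = 0.
  apply/lam0/lam0.
  by rewrite -(br (true, false, true) (false, false, true)) /e; unfoldK; ring.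
have b'd : b' * d = 0.
  apply/lam0/lam0.
  by rewrite -(br (true, false, true) (false, false, false)) /e; unfoldK; ring.
have ddg : d * (d - g') = 0.
  have : d * (d - g') - lam * d * (a' * d) - b' * d = 0.
    apply/lam0/lam0.
    by rewrite -(br (false, true, true) (false, false, false)) /e; unfoldK; ring.
  by rewrite a'd b'd mulr0 !subr0.
(* For delta <> 0 only family (i) survives. *)
have [d0|dn0] := eqVneq d 0; last first.
  have cancel (x : K) : x * d = 0 -> x = 0.
    by case/zeroM => // /eqP; rewrite (negbTE dn0).
  move/cancel: a'd => a'0; move/cancel: b'd => b'0.
  have /cancel/eqP : (d - g') * d = 0 by rewrite mulrC.
  rewrite subr_eq0 => /eqP dg.
  apply: Or31; left; rewrite /family_i /=; subst a' b' d.
  have g2 : g' = 2 by rewrite -[g']opprK -[2]opprK -tf1; congr (- _); ring.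
  by rewrite g2.
subst d => {a'd b'd ddg}.
have g'E : g' = b' + 2 + lam * a' by rewrite -[2]opprK -tf1; ring.
subst g' => {tf1}.
(* Now sigma exchanges v and dr, and the relation left is the one on v v v. *)
have f1 : (1 + lam * a') * (a' * (2 + lam * a')) = 0.
  apply/lam0/lam0; rewrite -oppr0.
  by rewrite -(br (true, true, true) (true, false, true)) /e; unfoldK; ring.
have f2 := br (true, true, true) (true, false, false).
have f3 := br (true, true, true) (false, false, true).
have f4 := br (true, true, true) (false, false, false).
have [p0|/zeroM[a'0|q0]] := zeroM _ _ f1.
- by apply: Or32; rewrite /= addr0 -[RHS]addr0 -p0; ring.
- apply: Or31; right; subst a'; rewrite /family_ii /=.
  have {}f4 : d' = 0.
    apply/two_0/lam0/lam0; rewrite -oppr0 -f4 /e; unfoldK; ring.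
  subst d'.
  have {}f2 : b' * (b' + 1) = 0.
    apply/two_0/lam0/lam0; rewrite -f2 /e; unfoldK; ring.
  have {}f3 : (b' + 2) * (b' + 1) = 0.
    apply/two_0/lam0/lam0; rewrite -oppr0 -f3 /e; unfoldK; ring.
  have b'1 : b' = - 1.
    apply/eqP; rewrite -subr_eq0 opprK; apply/eqP; apply: two_0.
    transitivity ((b' + 2) * (b' + 1) - b' * (b' + 1)); first ring.
    by rewrite f2 f3 subrr.
  by subst b'; split; split=> //; rewrite ?opprK //; ring.
- by apply: Or33; rewrite /= addr0 -[RHS]addr0 -q0; ring.
Qed.
End Classification.

(** * Locally constant functions on the punctured plane *)
Section Plane.
Variable R : realType.
Local Notation C := (CC R).
Local Open Scope classical_set_scope.

Definition of_real (t : R) : C := (t%:C)%C.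

Lemma of_real0 : of_real 0 = 0.
Proof. exact: (rmorph0 (real_complex R)). Qed.

Lemma of_real1 : of_real 1 = 1.
Proof. exact: (rmorph1 (real_complex R)). Qed.

Lemma of_realB s t : of_real (s - t) = of_real s - of_real t.
Proof. exact: (rmorphB (real_complex R)). Qed.

Lemma of_realM s t : of_real (s * t) = of_real s * of_real t.
Proof. exact: (rmorphM (real_complex R)). Qed.

Lemma norm_of_real t : `|of_real t| = of_real `|t|.
Proof. by rewrite [LHS]normc_def /= expr0n addr0 sqrtr_sqr. Qed.

Lemma lt_of_real s t : (of_real s < of_real t) = (s < t).
Proof. exact: ltcR. Qed.

Lemma le_of_real s t : (of_real s <= of_real t) = (s <= t).
Proof. exact: lecR. Qed.

Lemma realP (x : C) : x \is Num.real -> exists t, x = of_real t.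
Proof. by move/complex_realP. Qed.

Lemma ray_continuous (x : C) (t : R) (Q : C -> Prop) :
  (\forall y \near of_real t * x, Q y) -> \forall s \near t, Q (of_real s * x).
Proof.
move=> /nbhs_normP[/= e e0 eQ].
have [d ed] : exists d, e = of_real d by apply/realP/gtr0_real.
have [m xm] : exists m, `|x| = of_real m by apply/realP/normr_real.
have d0 : 0 < d by rewrite -lt_of_real -ed.
have m0 : 0 <= m by rewrite -le_of_real -xm; apply: normr_ge0.
apply/nbhs_normP; exists (d / (m + 1)) => /= [|s ts]; first by rewrite divr_gt0 // ltr_wpDl.
apply: eQ => /=.
rewrite -mulrBl -of_realB normrM norm_of_real xm ed -of_realM lt_of_real.
have : `|t - s| < d / (m + 1) := ts; rewrite ltr_pdivlMr ?ltr_wpDl //; apply: le_lt_trans.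
by rewrite ler_wpM2l // lerDl.
Qed.

(** Along the ray through x, the set of parameters where f takes the value l is
open and closed in the connected half-line, and is nonempty near 0. *)
Lemma locally_constant_punctured (T : Type) (f : C -> T) (l : T) :
  (forall x, x != 0 -> \forall y \near x, f y = f x) ->
  near_zero (fun x => f x = l) -> forall x, x != 0 -> f x = l.
Proof.
move=> loc near0 x x0.
pose p (t : R) : C := of_real t * x.
have p0 t : 0 < t -> p t != 0.
  by move=> t0; rewrite mulf_neq0 // gt_eqF // -of_real0 lt_of_real.
pose B := [set t : R | 0 < t /\ f (p t) = l].
have open_dec (D : set T) : open [set t : R | 0 < t /\ D (f (p t))].
  rewrite openE => t [t0 Dt].
  have := ray_continuous (loc _ (p0 t t0)) => fp.
  near=> s; split; first by near: s; apply: lt_nbhsr.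
  rewrite /p; suff -> : f (of_real s * x) = f (p t) by [].
  by near: s.
have conn : connected [set t : R | 0 < t].
  by apply/connected_intervalP => a b /= a0 b0 c /andP[ac _]; apply: lt_le_trans ac.
suff BE : B = [set t : R | 0 < t].
  have : B 1 by rewrite BE /= ltr01.
  by case=> _; rewrite /p of_real1 mul1r.
apply: conn.
- have : \forall t \near (0 : R), p t != 0 -> f (p t) = l.
    apply: (@ray_continuous x 0 (fun y => y != 0 -> f y = l)).
    by rewrite of_real0 mul0r; exact: near0.
  move=> /nbhs_normP[e /= e0 eP]; exists (e / 2); split; first by rewrite divr_gt0.
  apply: eP; last by rewrite p0 // divr_gt0.
  by rewrite /= sub0r normrN gtr0_norm ?divr_gt0 // ltr_pdivrMr // ltr_pMr // ltr1n.
- exists B; first exact: (open_dec [set l]).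
  by rewrite eqEsubset; split=> t [] //.
- exists (~` [set t : R | 0 < t /\ f (p t) <> l]).
    exact/open_closedC/(open_dec [set y | y <> l]).
  rewrite eqEsubset; split=> t [t0 ft]; split=> // ; first by case.
  by apply: contrapT => nl; apply: ft.
Unshelve. all: by end_near.
Qed.

End Plane.

Section NumField.
Variable K : numFieldType.
Local Open Scope classical_set_scope.

Lemma finite_values_locally_constant (f : K -> K) (s : seq K) (F : set_system K) (l : K) :
  ProperFilter F -> f @ F --> l -> (\forall y \near F, f y \in s) ->
  (\forall y \near F, f y = l).
Proof.
move=> PF fl fs; pose s' := rem l (undup s).
have cl : closed [set` s'].
  apply: accessible_finite_set_closed.1; last exact: finite_seq.
  exact/hausdorff_accessible/norm_hausdorff.
have l's : nbhs l (~` [set` s']).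
  apply: open_nbhs_nbhs; split; first exact: closed_openC.
  by rewrite /= /s' mem_rem_uniq ?undup_uniq // inE eqxx.
have := fl _ l's; rewrite nbhs_filterE => ev.
near=> y.
have : f y \notin s' by apply/negP; near: y.
rewrite mem_rem_uniq ?undup_uniq // inE mem_undup negb_and negbK.
suff -> : f y \in s by rewrite orbF => /eqP.
by near: y.
Unshelve. all: by end_near.
Qed.

Lemma punctured_id_cvg0 : (x : K) @[x --> (0 : K)^'] --> (0 : K).
Proof. exact: (cvg_within_filter _ cvg_id). Qed.

Lemma near_zero_neq0 : near_zero (fun lam : K => lam != 0).
Proof. exact: (nbhs_dnbhs_neq (0 : K)). Qed.

End NumField.

(** * Classification *)
Section Families.
Variable K : numFieldType.
Local Open Scope classical_set_scope.

Let two_neq0 : 2 != 0 :> K.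
Proof. by rewrite pnatr_eq0. Qed.

Let two_neq1 : 2 != 1 :> K.
Proof. exact: (negbT (eqr_nat K 2 1)). Qed.

(** In the basis dr, v / lambda the torsion and braid equations no longer involve
lambda; this is the combination of the rescaled coefficients whose value
separates the components of their solution set. *)
Definition braid_index (c : K -> coefs K) (lam : K) : K := lam * (alpha' (c lam) + beta (c lam)).

Lemma braid_index_values c lam : lam != 0 ->
  torsion_free_braided lam (c lam) -> braid_index c lam \in [:: 0; - 1; - 2].
Proof.
move=> l0 /(torsion_free_braided_cases l0 two_neq0).
case=> [[/family_iE|/family_iiE]|e|e]; rewrite /braid_index ?e; last 2 first.
- by rewrite !inE eqxx orbT.
- by rewrite !inE eqxx !orbT.
all: by move=> ->; rewrite addr0 mulr0 !inE eqxx.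
Qed.

Lemma braid_index0_family c lam : lam != 0 ->
  torsion_free_braided lam (c lam) -> braid_index c lam = 0 ->
  family_i (c lam) \/ family_ii (c lam).
Proof.
move=> l0 /(torsion_free_braided_cases l0 two_neq0) [//|e|e];
  rewrite /braid_index e => /eqP; rewrite oppr_eq0 ?oner_eq0 //.
by rewrite (negbTE two_neq0).
Qed.

Lemma family_braid_index (c : K -> coefs K) lam :
  family_i (c lam) \/ family_ii (c lam) -> braid_index c lam = 0.
Proof.
by case=> [/family_iE|/family_iiE]; rewrite /braid_index => ->; rewrite addr0 mulr0.
Qed.

Lemma family_torsion_free_braided (lam : K) c :
  family_i c \/ family_ii c -> torsion_free_braided lam c.
Proof.
move=> fam; have [nabla [sigma ans]] := ansatz_exists lam c.
by exists nabla, sigma; have [tf [br _]] := family_properties fam ans.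
Qed.

Lemma gamma'_values (c : coefs K) : family_i c \/ family_ii c ->
  gamma' c \in [:: 2; 1].
Proof. by case=> [/family_iE|/family_iiE] ->; rewrite !inE eqxx ?orbT. Qed.

Lemma family_by_gamma' (c : coefs K) : family_i c \/ family_ii c ->
  if gamma' c == 1 then family_ii c else family_i c.
Proof.
case=> fam; first by rewrite {1}(family_iE fam) /= (negbTE two_neq1).
by rewrite {1}(family_iiE fam) /= eqxx.
Qed.

Lemma classification_near_zero (c : K -> coefs K) : classical_limit c ->
  near_zero (fun lam => torsion_free_braided lam (c lam)) ->
  near_zero (fun lam => family_i (c lam)) \/
  near_zero (fun lam => family_ii (c lam)).
Proof.
move=> [_ [[lb cb] [_ [_ [[la' ca'] [_ [[lg' cg'] _]]]]]]] tfb.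
have index_cvg : braid_index c lam @[lam --> (0 : K)^'] --> (0 : K).
  have FF : Filter (0 : K)^' by apply: dnbhs_filter.
  have := cvgM (@punctured_id_cvg0 _) (cvgD ca' cb).
  by rewrite mul0r => prod_cvg; apply: prod_cvg.
have index0 : near_zero (fun lam => braid_index c lam = 0).
  apply: (finite_values_locally_constant (s := [:: 0; - 1; - 2])) index_cvg _.
  near=> lam; apply: braid_index_values; near: lam.
    exact: near_zero_neq0.
  exact: tfb.
have fam : near_zero (fun lam => family_i (c lam) \/ family_ii (c lam)).
  rewrite /near_zero; near=> lam; apply: braid_index0_family; near: lam.
  - exact: near_zero_neq0.
  - exact: tfb.
  - exact: index0.
have g'E : near_zero (fun lam => gamma' (c lam) = lg').
  apply: (finite_values_locally_constant (s := [:: 2; 1])) cg' _.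
  by near=> lam; apply: gamma'_values; near: lam.
have [l1|ln1] := eqVneq lg' 1; [right|left]; rewrite /near_zero; near=> lam.
  have /family_by_gamma' : family_i (c lam) \/ family_ii (c lam) by near: lam.
  suff -> : gamma' (c lam) = lg' by rewrite l1 eqxx.
  by near: lam.
have /family_by_gamma' : family_i (c lam) \/ family_ii (c lam) by near: lam.
suff -> : gamma' (c lam) = lg' by rewrite (negbTE ln1).
by near: lam.
Unshelve. all: by end_near.
Qed.

(** A form of connectedness of the punctured line, which fails over a real field
and holds over the complex numbers. *)
Hypothesis punctured_connected : forall (f : K -> K) (l : K),
  (forall x, x != 0 -> \forall y \near x, f y = f x) ->
  near_zero (fun x => f x = l) -> forall x, x != 0 -> f x = l.

Lemma finite_values_constant (f : K -> K) (s : seq K) (l : K) :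
  (forall lam, lam != 0 -> {for lam, continuous f}) ->
  (forall lam, lam != 0 -> f lam \in s) ->
  near_zero (fun lam => f lam = l) -> forall lam, lam != 0 -> f lam = l.
Proof.
move=> fc fs near0; apply: (punctured_connected _ near0) => x x0.
apply: (finite_values_locally_constant (s := s)) (fc x x0) _.
near=> y; apply: fs; near: y.
exact: (cvgr_neq0 _ cvg_id x0).
Unshelve. all: by end_near.
Qed.

Lemma classification_punctured (c : K -> coefs K) :
  classical_limit c -> continuous_family c ->
  (forall lam : K, lam != 0 -> torsion_free_braided lam (c lam)) ->
  (forall lam : K, lam != 0 -> family_i (c lam)) \/
  (forall lam : K, lam != 0 -> family_ii (c lam)).
Proof.
move=> lim [_ [cb [_ [_ [ca' [_ [cg' _]]]]]]] tfb.
have near_fam : near_zero (fun lam => family_i (c lam)) \/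
    near_zero (fun lam => family_ii (c lam)).
  apply: classification_near_zero => //; rewrite /near_zero; near=> lam; apply: tfb; near: lam.
  exact: near_zero_neq0.
have index0 lam : lam != 0 -> braid_index c lam = 0.
  apply: (finite_values_constant (s := [:: 0; - 1; - 2])) => [x x0|x x0|].
  - have := cvgM (@cvg_id _ (nbhs x)) (cvgD (ca' x x0) (cb x x0)).
    by move=> prod_cvg; apply: prod_cvg.
  - exact: braid_index_values (tfb _ x0).
  - by case: near_fam => near_fam; rewrite /near_zero; near=> x; apply: family_braid_index;
      [left|right]; near: x.
have fam lam : lam != 0 -> family_i (c lam) \/ family_ii (c lam).
  by move=> l0; apply: braid_index0_family (tfb _ l0) (index0 _ l0).
have g'E l : near_zero (fun lam => gamma' (c lam) = l) ->
    forall lam, lam != 0 -> gamma' (c lam) = l.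
  apply: (finite_values_constant (s := [:: 2; 1])) => // x x0.
  exact/gamma'_values/fam.
case: near_fam => near_fam; [left|right] => lam l0; have := family_by_gamma' (fam _ l0).
  rewrite (g'E 2) ?(negbTE two_neq1) //; rewrite /near_zero; near=> x.
  suff /family_iE -> : family_i (c x) by [].
  by near: x.
rewrite (g'E 1) ?eqxx //; rewrite /near_zero; near=> x.
suff /family_iiE -> : family_ii (c x) by [].
by near: x.
Unshelve. all: by end_near.
Qed.

End Families.

Lemma family_i_sigma (K : fieldType) (lam : K) (c : coefs K) nabla sigma :
  ansatz_connection c nabla sigma -> family_i c -> @sigma_i K lam (delta' c) sigma.
Proof.
rewrite /sigma_i => -[_ [_ [_ [_ [_ [-> ->]]]]]] /family_iE ->; split=> /=.
  rewrite comb_kvec !tens_bas !bas_kvec -kvecZ -kvecD; apply: eq_kvec.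
  by case=> [[] []] /=; ring.
rewrite comb_kvec !tens_bas !bas_kvec -!kvecZ -!kvecD; apply: eq_kvec.
by case=> [[] []] /=; ring.
Qed.

Lemma family_ii_sigma (K : fieldType) (lam : K) (c : coefs K) nabla sigma :
  ansatz_connection c nabla sigma -> family_ii c -> @sigma_ii K lam sigma.
Proof.
rewrite /sigma_ii => -[_ [_ [_ [_ [_ [-> ->]]]]]] /family_iiE ->; split=> /=.
  rewrite comb_kvec !tens_bas !bas_kvec; apply: eq_kvec.
  by case=> [[] []] /=; ring.
rewrite comb_kvec /vr /dr !bas_kvec -kvecZ -kvecN -kvecD !tens_kvec -kvecZ -kvecD.
by apply: eq_kvec; case=> [[] []] /=; ring.
Qed.

Theorem proposition6p4 (R : realType) :
  (forall c : CC R -> coefs (CC R),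
     classical_limit c ->
     (near_zero (fun lam => torsion_free_braided lam (c lam)) <->
      near_zero (fun lam => family_i (c lam)) \/
      near_zero (fun lam => family_ii (c lam)))) /\
  (forall c : CC R -> coefs (CC R),
     classical_limit c -> continuous_family c ->
     ((forall lam : CC R, lam != 0 -> torsion_free_braided lam (c lam)) <->
      (forall lam : CC R, lam != 0 -> family_i (c lam)) \/
      (forall lam : CC R, lam != 0 -> family_ii (c lam)))) /\
  (forall (lam : CC R) (c : coefs (CC R)),
     lam != 0 -> family_i c \/ family_ii c ->
     (exists nabla sigma, @ansatz_connection (CC R) lam c nabla sigma) /\
     forall nabla sigma, @ansatz_connection (CC R) lam c nabla sigma ->
       (family_i c -> sigma_i (delta' c) sigma) /\
       (family_ii c -> sigma_ii sigma) /\
       torsion_free nabla /\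
       braided sigma /\
       extendable sigma /\
       wedge_compatible nabla sigma /\
       leibniz_compatible nabla sigma /\
       flat nabla).
Proof.
split=> [c lim|]; last split=> [c lim cont|lam c _ fam].
- split; first exact: classification_near_zero.
  by case=> fam; rewrite /near_zero; near=> lam; apply: family_torsion_free_braided; [left|right];
    near: lam.
- split; first exact: (classification_punctured (@locally_constant_punctured R (CC R)) lim cont).
  by case=> fam lam l0; apply: family_torsion_free_braided; [left|right];
    apply: fam.
- split=> [|nabla sigma ans]; first exact: ansatz_exists.
  split; first exact: family_i_sigma ans.
  split; first exact: family_ii_sigma ans.
  exact: family_properties fam ans.
Unshelve. all: by end_near.
Qed.
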